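(* Let $T$ be a PTE-tree and let $T'$ be a finite tree such that $U(T)=U(T')$. Then $T'$ is isomorphic to $T$.
   Context: $U$-polynomial: let $x_1,x_2,\ldots$ be commuting indeterminates. For a partition $\lambda=(\lambda_1,\ldots,\lambda_l)$ put $\mathbf{x}_\lambda=x_{\lambda_1}\cdots x_{\lambda_l}$. For a finite tree $T=(V,E)$ and $A\subseteq E$, let $\lambda(A)$ be the partition of $|V|$ whose parts are the numbers of vertices of the connected components of the spanning subgraph $(V,A)$. The $U$-polynomial of the tree $T$ is $U(T)=\sum_{A\subseteq E}\mathbf{x}_{\lambda(A)}$. PTE-trees: an $n$-path is a path with $n$ vertices, and an $n$-star is $K_{1,n-1}$. For non-negative integers $a,b$, $B(a,b)$ is the rooted tree obtained from $a$ disjoint copies of the 4-path and $b$ disjoint copies of the 4-star by identifying one leaf of each copy into a single common vertex, the root; $B(0,0)$ is a single vertex. For sequences $p=(p_1,\ldots,p_n)$, $s=(s_1,\ldots,s_n)$ of non-negative integers with $n\ge 2$, $T(p,s)$ is the tree obtained from the disjoint union of $B(p_1,s_1),\ldots,B(p_n,s_n)$, with roots $v_1,\ldots,v_n$, by adding a new vertex $c$ joined by an edge to each $v_i$. For a positive integer $\alpha$, a sequence $p=(p_1,\ldots,p_n)$ of non-negative integers is $\alpha$-compatible if $n\ge2$ and $\max_i p_i\le\alpha$; then $T_\alpha(p):=T(p,\alpha-p)$ where $\alpha-p=(\alpha-p_1,\ldots,\alpha-p_n)$. A PTE-tree is a tree isomorphic to $T_\alpha(p)$ for some positive integer $\alpha$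 and some $\alpha$-compatible sequence $p$. *)

(* Defs.v *)
From mathcomp Require Import all_boot all_order all_algebra.
From mathcomp Require Import finmap.
From mathcomp.multinomials Require Import monalg.

Set Implicit Arguments.
Unset Strict Implicit.
Unset Printing Implicit Defensive.

Import GRing.Theory.
Local Open Scope ring_scope.

(** * Finite simple graphs and trees *)

Record sgraph := SGraph {
  vertex :> finType;
  adj : rel vertex;
  adj_sym : symmetric adj;
  adj_irr : irreflexive adj }.

Definition isomorphic (G H : sgraph) : Prop :=
  exists2 f : G -> H, bijective f & {mono f : x y / adj x y}.

(* [ucycle] also holds of sequences of length at most 2 such as [:: x; y] with
   x adjacent to y, which are not cycles of a simple graph. *)
Definition acyclic (G : sgraph) : Prop :=
  forall s : seq G, ucycle (@adj G) s -> (size s <= 2)%N.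

Definition tree (G : sgraph) : Prop :=
  [/\ (0 < #|G|)%N, forall x y : G, connect (@adj G) x y & acyclic G].

Definition edges (G : sgraph) : {set {set G}} :=
  [set [set x; y] | x in G, y in adj x].

(** * The U-polynomial *)

(* For A \subset edges G no singleton belongs to A, so this has no loops. *)
Definition spanning_adj (G : sgraph) (A : {set {set G}}) : rel G :=
  fun x y => [set x; y] \in A.

Definition components (G : sgraph) (A : {set {set G}}) : {set {set G}} :=
  equivalence_partition (connect (spanning_adj A)) [set: G].

Definition lambda (G : sgraph) (A : {set {set G}}) : seq nat :=
  sort geq [seq #|C : {set G}| | C <- enum (components A)].

(* Polynomials with integer coefficients in countably many commuting
   indeterminates, indexed by nat; the one of index 0 never occurs in
   [Upoly G]. *)
Notation xpoly := {malg int[{cmonom nat}]}.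

Definition xvar (i : nat) : xpoly := << ucm i >>.

Definition xmon (l : seq nat) : xpoly := \prod_(i <- l) xvar i.

Definition Upoly (G : sgraph) : xpoly :=
  \sum_(A : {set {set G}} | A \subset edges G) xmon (lambda A).

(** * PTE-trees *)

(* Both graphs below have vertices 0, 1, 2, 3, and 0 is a leaf of each. *)
Definition path4_rel : rel 'I_4 :=
  fun i j => (i.+1 == j :> nat) || (j.+1 == i :> nat).

(* K_{1,3} with centre 1. *)
Definition star4_rel : rel 'I_4 :=
  fun i j => (i == 1%N :> nat) (+) (j == 1%N :> nat).

Lemma path4_sym : symmetric path4_rel.
Proof. by move=> i j; rewrite /path4_rel orbC. Qed.
Lemma path4_irr : irreflexive path4_rel.
Proof. by move=> i; rewrite /path4_rel orbb gtn_eqF. Qed.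
Lemma star4_sym : symmetric star4_rel.
Proof. by move=> i j; rewrite /star4_rel addbC. Qed.
Lemma star4_irr : irreflexive star4_rel.
Proof. by move=> i; rewrite /star4_rel addbb. Qed.

Definition path4 := SGraph path4_sym path4_irr.
Definition star4 := SGraph star4_sym star4_irr.

Section RootedB.
Variables a b : nat.

(* [None] is the root, i.e. the vertex 0 common to all copies;
   [Some (k, j)] is the vertex [lift ord0 j] = j + 1 of the k-th copy. *)
Definition B_vertex : finType := option (('I_a + 'I_b) * 'I_3)%type.

Definition B_copy (k : 'I_a + 'I_b) : rel 'I_4 :=
  if k is inl _ then @adj path4 else @adj star4.

Definition B_rel : rel B_vertex := fun u v =>
  match u, v with
  | None, None => false
  | None, Some (k, j) => B_copy k ord0 (lift ord0 j)
  | Some (k, i), None => B_copy k (lift ord0 i) ord0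
  | Some (k, i), Some (k', j) =>
      (k == k') && B_copy k (lift ord0 i) (lift ord0 j)
  end.

Lemma B_copy_sym k : symmetric (B_copy k).
Proof. by case: k => ?; [apply: path4_sym | apply: star4_sym]. Qed.
Lemma B_copy_irr k : irreflexive (B_copy k).
Proof. by case: k => ?; [apply: path4_irr | apply: star4_irr]. Qed.

Lemma B_sym : symmetric B_rel.
Proof.
move=> [[k i]|] [[k' j]|] //=; try exact: B_copy_sym.
by rewrite eq_sym; case: eqP => // ->; apply: B_copy_sym.
Qed.
Lemma B_irr : irreflexive B_rel.
Proof. by move=> [[k i]|] //=; rewrite eqxx B_copy_irr. Qed.

Definition B := SGraph B_sym B_irr.
Definition B_root : B := None.

End RootedB.

Section TreeT.
Variables (n : nat) (p s : 'I_n -> nat).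

(* [None] is the new vertex c. *)
Definition T_vertex : finType := option {i : 'I_n & B (p i) (s i)}.

Definition T_rel : rel T_vertex := fun u v =>
  match u, v with
  | None, None => false
  | None, Some x | Some x, None => tagged x == B_root _ _
  | Some x, Some y => (tag x == tag y) && adj (tagged x) (tagged_as x y)
  end.

Lemma T_sym : symmetric T_rel.
Proof.
move=> [[i x]|] [[j y]|] //=; case: (eqVneq i j) => [ij|//].
by case: j / ij y => y; rewrite !tagged_asE; apply: B_sym.
Qed.
Lemma T_irr : irreflexive T_rel.
Proof. by move=> [[i x]|] //=; rewrite eqxx tagged_asE; apply: B_irr. Qed.

Definition Tgraph := SGraph T_sym T_irr.

End TreeT.

Definition compatible (alpha n : nat) (p : 'I_n -> nat) : Prop :=
  (2 <= n)%N /\ (\max_(i < n) p i <= alpha)%N.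

(* The subtraction of naturals is exact when p is alpha-compatible. *)
Definition Talpha (alpha n : nat) (p : 'I_n -> nat) : sgraph :=
  Tgraph p (fun i => alpha - p i)%N.

Definition PTE_tree (G : sgraph) : Prop :=
  tree G /\
  exists (alpha n : nat) (p : 'I_n -> nat),
    [/\ (0 < alpha)%N, compatible alpha p & isomorphic G (Talpha alpha p)].

(* Main.v *)
Require Import Defs.
From mathcomp Require Import all_boot all_order all_algebra zify.
From mathcomp Require Import finmap.
From mathcomp.multinomials Require Import monalg.

Set Implicit Arguments.
Unset Strict Implicit.
Unset Printing Implicit Defensive.

Import GRing.Theory Num.Theory.

(** Root T = T_alpha(p) at the vertex c joined to the roots of the branches, and
    put m = 3 alpha + 1. The subtree of a vertex other than c has m vertices (the
    vertex is the root of a branch), 3 (it starts a leg, that is a copy of the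
    4-path or of the 4-star without the root), 2 (it is the second vertex of a
    path leg) or 1. The whole tree has 1 + n m vertices.

    The polynomial U counts the edge sets with any prescribed component sizes
    ([Upoly_lambda_count]). Deleting one edge of a rooted tree splits off the
    subtree below it, so U knows how many subtrees of each size there are,
    provided the tree is rooted at a centroid, where the part split off is
    recognized as the smaller one. Hence T', rooted at a centroid, has as many
    subtrees of each size as T. Subtrees of equal size are disjoint; so the n
    subtrees of size m cover everything but the root, and must be its children;
    likewise the n alpha subtrees of size 3 must be the children of the roots of
    the branches. A subtree of size 3 is a path leg or a star leg. So T' is built
    like T, from n branches of alpha legs each ([pte_of_lambda]), and only the
    numbers q_v of path legs in the branches v may differ.

    To compare these numbers up to order, detach from the root all branches but
    one, v, and delete the middle edges of j path legs of v. The components have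
    sizes m (n - 1 times), m + 1 - 2 j (once) and 2 (j times). As long as
    m + 1 - 2 j > 3 no other edge set has these component sizes, so U determines
    the sum over v of the binomial coefficients (q_v choose j)
    ([lambda_count_path_cut]). The inequality holds for j <= alpha except when
    alpha = j = 1, and then the sum is the number of subtrees of size 2, which is
    already known. Since q_v <= alpha, these sums determine the multiset of
    the q_v ([binomial_sums_determine]).

    Finally, the size of the subtree below a vertex and the number of path legs
    in it determine the same two numbers for its children, up to order; hence a
    bijection of T' with T is built from the root down ([label_iso]). *)

(** * Edge sets counted by component sizes *)

Definition monomial_of (l : seq nat) : {cmonom nat} :=
  \big[mmul/mone]_(i <- l) ucm i.

Lemma monomial_ofE l i : monomial_of l i = count_mem i l.
Proof.
rewrite /monomial_of; elim: l => [|a l IH]; first by rewrite big_nil cm1.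
by rewrite big_cons cmM IH cmU.
Qed.

Lemma xmonE l : xmon l = << monomial_of l >>%R.
Proof.
rewrite /xmon /monomial_of; elim: l => [|a l IH].
  by rewrite !big_nil.
rewrite !big_cons IH.
have -> : (xvar a * << monomial_of l >> =
  fgmul << 1 *g ucm a >> << 1 *g monomial_of l >>)%R by exact: malgM_def.
rewrite (fgmulUU (1 : int) 1 (ucm a) (monomial_of l)).
rewrite (mulr1 (1 : int)).
reflexivity.
Qed.

Lemma mcoeff_xmon l l' : (xmon l)@_(monomial_of l') = ((perm_eq l l')%:R)%R.
Proof.
rewrite xmonE mcoeffU1; congr ((nat_of_bool _)%:R)%R.
apply/cmP/permP => [E a | E i]; last by rewrite !monomial_ofE E.
have /permP -> // : perm_eq l l'.
by apply/allP => x _ /=; rewrite -!monomial_ofE E.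
Qed.

Lemma lambda_sorted (G : sgraph) (A : {set {set G}}) : sorted geq (lambda A).
Proof. by apply: sort_sorted => x y; rewrite /geq /= leq_total. Qed.

Definition lambda_count (G : sgraph) (g : pred (seq nat)) : nat :=
  #|[set A : {set {set G}} | (A \subset edges G) && g (lambda A)]|.

Definition lambdas (G : sgraph) : seq (seq nat) :=
  [seq lambda A | A : {set {set G}} in powerset (edges G)].

Lemma lambda_countE (G : sgraph) g : lambda_count G g = count g (lambdas G).
Proof.
rewrite /lambdas /image_mem count_map -size_filter /lambda_count cardE.
rewrite /enum_mem -filter_predI.
rewrite size_filter [RHS]size_filter; apply: eq_count => A /=.
by rewrite !inE andbC.
Qed.

Lemma mcoeff_Upoly (G : sgraph) l : sorted geq l ->
  ((Upoly G)@_(monomial_of l) = (count_mem l (lambdas G))%:R)%R.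
Proof.
move=> sl; rewrite /Upoly raddf_sum /= -lambda_countE /lambda_count -sum1_card.
rewrite natr_sum big_mkcond [RHS]big_mkcond /=; apply: eq_bigr => A _.
rewrite inE; case: (A \subset edges G) => //=.
rewrite mcoeff_xmon; case: eqP => [<-|ne]; first by rewrite perm_refl.
case: (boolP (perm_eq _ _)) => // pe; case: ne.
apply: (sorted_eq _ _ (lambda_sorted A) sl pe).
- by move=> x y z; rewrite /geq /= => h1 h2; apply: leq_trans h2 h1.
- by move=> x y; rewrite /geq /= => /anti_leq.
Qed.

(** The monomials of distinct sorted sequences are distinct, so equality of the
    polynomials is equality of the multisets of all [lambda A]. It is used through
    arbitrary predicates [g], which avoids writing size sequences explicitly. *)
Lemma Upoly_lambda_count (G H : sgraph) : Upoly G = Upoly H ->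
  forall g, lambda_count G g = lambda_count H g.
Proof.
move=> E g; rewrite !lambda_countE; move: g; apply/permP.
apply/allP => l; rewrite mem_cat => lin; apply/eqP.
have sl : sorted geq l.
  by case/orP: lin => /imageP [A _ ->]; apply: lambda_sorted.
have := mcoeff_Upoly G sl; rewrite E mcoeff_Upoly // => /eqP.
by rewrite eqr_nat => /eqP.
Qed.

(** * Trees rooted by a parent function *)

Lemma set2_eq (T : finType) (u v x y : T) :
  [set u; v] = [set x; y] -> u = x /\ v = y \/ u = y /\ v = x.
Proof.
move=> E; have /set2P u_xy : u \in [set x; y] by rewrite -E set21.
have /set2P v_xy : v \in [set x; y] by rewrite -E set22.
have /set2P x_uv : x \in [set u; v] by rewrite E set21.
have /set2P y_uv : y \in [set u; v] by rewrite E set22.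
case: u_xy y_uv x_uv => -> yv xv.
  by left; split=> //; case: yv v_xy => [-> []|].
by right; split=> //; case: xv v_xy => [-> []|].
Qed.

(** The root is a fixed point of [par], so that ancestors are the points reached
    by iterating [par], and [fconnect par x z] says that [z] is [x] or an ancestor
    of [x]. *)
Definition rooted (G : sgraph) (c : G) (par : G -> G) : Prop :=
  [/\ par c = c, forall x, fconnect par x c &
      forall x y, adj x y = (x != c) && (par x == y) || (y != c) && (par y == x)].

Section Rooted.
Variables (G : sgraph) (c : G) (par : G -> G).
Hypothesis rt : rooted c par.

Let par_c : par c = c. Proof. by case: rt. Qed.

Lemma rooted_ind (P : G -> Prop) :
  P c -> (forall x, x != c -> P (par x) -> P x) -> forall x, P x.
Proof.
move=> Pc Pstep x; have [_ /(_ x) /iter_findex + _] := rt.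
move: (findex par x c) => k; elim: k x => [|k IH] x /=; first by move=> ->.
rewrite -iterS iterSr => /IH Pp; case: (eqVneq x c) => [-> //|xc].
exact: Pstep.
Qed.

Lemma par_neq x : x != c -> par x != x.
Proof.
move=> xc; apply/eqP => E; have [_ _ /(_ x x)] := rt.
by rewrite adj_irr xc E eqxx.
Qed.

Lemma fconnect_parE x z :
  fconnect par x z = (x == z) || (x != c) && fconnect par (par x) z.
Proof.
apply/idP/idP => [/iter_findex|/orP [/eqP-> //|/andP [_]]]; last first.
  exact/connect_trans/fconnect1.
case: (findex par x z) => [/= ->|k]; first by rewrite eqxx.
rewrite iterSr; case: (eqVneq x c) => [->|xc] /= <-.
  suff -> : iter k par (par c) = c by rewrite eqxx.
  by rewrite -iterSr iter_fix.
by rewrite fconnect_iter orbT.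
Qed.

Lemma fconnect_c z : fconnect par c z = (c == z).
Proof. by rewrite fconnect_parE eqxx orbF. Qed.

Lemma fconnect_anti x z : fconnect par x z -> fconnect par z x -> x = z.
Proof.
elim/rooted_ind: x z => [z|x xc IH z]; first by rewrite fconnect_c => /eqP.
rewrite fconnect_parE xc => /orP [/eqP //|/= pz] zx.
have E : par x = z by apply: IH => //; apply: connect_trans zx (fconnect1 _ _).
have /eqP := IH x (etrans (congr1 (fconnect par ^~ x) E) zx) (fconnect1 _ _).
by rewrite (negbTE (par_neq xc)).
Qed.

(** The ancestors of [u] form a chain; hence two subtrees are nested or disjoint. *)
Lemma fconnect_total u x y : fconnect par u x -> fconnect par u y ->
  fconnect par x y || fconnect par y x.
Proof.
elim/rooted_ind: u => [|u uc IH].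
  by rewrite !fconnect_c => /eqP <- /eqP <-; rewrite connect0.
move=> ux uy; move: (ux) (uy); rewrite !(fconnect_parE u) uc /=.
case/orP => [/eqP <-|px]; first by rewrite uy.
by case/orP => [/eqP <-|py]; [rewrite ux orbT | apply: IH].
Qed.

Definition subtree z := [set x | fconnect par x z].

Lemma mem_sub x : x \in subtree x.
Proof. by rewrite inE. Qed.

Lemma sub_c : subtree c = setT.
Proof. by apply/setP => x; rewrite !inE; case: rt => _ ->. Qed.

Lemma sub_sub x z : x \in subtree z -> subtree x \subset subtree z.
Proof.
by rewrite inE => xz; apply/subsetP => y; rewrite !inE => /connect_trans ->.
Qed.

Lemma card_sub_lt x z : x \in subtree z -> x != z -> #|subtree x| < #|subtree z|.
Proof.
move=> xz ne; apply: proper_card; rewrite properE sub_sub //=.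
apply/subsetPn; exists z; rewrite ?mem_sub // inE; apply: contra ne => zx.
by apply/eqP/fconnect_anti => //; rewrite inE in xz.
Qed.

Lemma par_in_sub x : x \in subtree (par x).
Proof. by rewrite inE fconnect1. Qed.

Lemma card_sub_par x : x != c -> #|subtree x| < #|subtree (par x)|.
Proof. by move=> xc; apply: card_sub_lt (par_in_sub x) _; rewrite eq_sym par_neq. Qed.

Definition child z : pred G := fun y => (y != c) && (par y == z).

Lemma child_above_unique x z y y' : child z y -> child z y' ->
  x \in subtree y -> x \in subtree y' -> y = y'.
Proof.
suff H u v : child z u -> child z v -> fconnect par u v -> u = v.
  rewrite !inE => cy cy' xy xy'.
  by case/orP: (fconnect_total xy xy') => h; [|symmetry]; apply: H.
case/andP => uc /eqP pu /andP [vc /eqP pv].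
rewrite fconnect_parE uc pu -pv => /orP [/eqP //|/= h].
by case/eqP: (par_neq vc); apply: fconnect_anti h (fconnect1 _ _).
Qed.

Lemma child_above x z : x \in subtree z -> x != z -> exists2 y, child z y & x \in subtree y.
Proof.
elim/rooted_ind: x => [|x xc IH]; first by rewrite inE fconnect_c => ->.
rewrite inE fconnect_parE => /orP [->//|/andP [_ pz]] xz.
case: (eqVneq (par x) z) => [pxz|ne].
  by exists x; [rewrite /child xc pxz eqxx | rewrite mem_sub].
case: IH => [|//|y cy py]; first by rewrite inE.
by exists y => //; rewrite !inE in py *; apply: connect_trans py; apply: fconnect1.
Qed.

(** The subtrees below the children of [z] partition the subtree below [z] minus
    [z]; every recursive count on subtrees is an instance. *)
Lemma sum_sub (w : G -> nat) z :
  \sum_(x in subtree z) w x = w z + \sum_(y | child z y) \sum_(x in subtree y) w x.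
Proof.
rewrite (exchange_big_dep (mem (subtree z :\ z))) /=; last first.
  move=> y x /andP [yc /eqP <-] xy; rewrite !inE.
  rewrite inE in xy; rewrite (connect_trans xy (fconnect1 _ _)) andbT.
  apply: contraNneq (par_neq yc) => E; rewrite -E in xy *.
  by apply/eqP/fconnect_anti => //; rewrite E fconnect1.
rewrite (big_setD1 z) ?mem_sub //=; congr (_ + _); apply: eq_bigr => x.
case/setD1P => xz xsz; have [y cy xy] := child_above xsz xz.
rewrite (big_pred1 y) // => y' /=; apply/andP/eqP => [[cy' xy']|-> //].
exact: child_above_unique cy' cy xy' xy.
Qed.

Lemma card_subE z : #|subtree z| = (\sum_(y | child z y) #|subtree y|).+1.
Proof.
rewrite -sum1_card sum_sub add1n; congr _.+1.
by apply: eq_bigr => y _; rewrite sum1_card.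
Qed.

(** ** Deleting the edges above a set of vertices *)

Definition par_edge x : {set G} := [set x; par x].

(** An edge is determined by its lower end, so that edge sets to be deleted are
    sets of vertices other than the root. *)
Lemma edgesE : edges G = par_edge @: [set~ c].
Proof.
have [_ _ adjE] := rt; apply/setP => e; apply/imset2P/imsetP.
  case=> x y _ xy; have : adj x y by exact: xy.
  rewrite adjE => /orP [] /andP [nc /eqP <-] ->.
    by exists x; rewrite ?inE.
  by exists y; rewrite ?inE // setUC.
case=> x; rewrite !inE => xc ->.
have xp : adj x (par x) by rewrite adjE xc eqxx.
by exists x (par x).
Qed.

Lemma par_edge_inj : {in [set~ c] &, injective par_edge}.
Proof.
move=> x y _ _ /set2_eq [[] //|[xy yx]].
by apply: fconnect_anti; [rewrite -yx | rewrite xy]; apply: fconnect1.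
Qed.

Section Cut.
Variable X : {set G}.

(** [top x] is the first element of [c |: X] among [x] and its ancestors: the
    uppermost vertex of the component of [x] once the edges above [X] are deleted.
    As [step] is stationary on [c |: X], iterating it [#|G|] times is enough. *)
Definition step x := if x \in c |: X then x else par x.
Definition top x := iter #|G| step x.

Lemma top_in x : top x \in c |: X.
Proof.
have [_ /(_ x) cx _] := rt.
have fixS y k : y \in c |: X -> iter k step y = y.
  by move=> yS; apply: iter_fix; rewrite /step yS.
have reach k y : iter k par y = c -> iter k step y \in c |: X.
  elim: k y => [y /= ->|k IH y]; first by rewrite setU11.
  case: (boolP (y \in c |: X)) => yS; first by rewrite fixS.
  by rewrite !iterSr {2}/step (negbTE yS) => /IH.
have lt : findex par x c <= #|G|.
  by apply: leq_trans (ltnW (findex_max cx)) _; apply: max_card.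
rewrite /top -(subnK lt) iterD fixS; apply: reach; exact: iter_findex.
Qed.

Lemma top_fix x : x \in c |: X -> top x = x.
Proof. by move=> xS; apply: iter_fix; rewrite /step xS. Qed.

Lemma top_par x : x \notin c |: X -> top (par x) = top x.
Proof.
move=> xS; rewrite /top; have -> : par x = step x by rewrite /step (negbTE xS).
by rewrite -iterSr iterS {1}/step top_in.
Qed.

Lemma top_in_sub z x : z \in c |: X -> (top x \in subtree z) = (x \in subtree z).
Proof.
move=> zS; rewrite !inE; elim/rooted_ind: x => [|x xc IH].
  by rewrite top_fix ?setU11.
case: (boolP (x \in c |: X)) => xS; first by rewrite top_fix.
rewrite -top_par // IH [RHS]fconnect_parE xc.
by case: eqP xS => [->|] //; rewrite zS.
Qed.

Definition part z := [set x | top x == z].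

(** No component meets the subtree below an element [z] of [c |: X] without being
    contained in it. *)
Lemma card_subtree_parts z : z \in c |: X ->
  #|subtree z| = \sum_(y in (c |: X) :&: subtree z) #|part y|.
Proof.
move=> zS; rewrite -sum1_card (partition_big top (mem ((c |: X) :&: subtree z))) /=.
  apply: eq_bigr => y /setIP [_ yz]; rewrite -sum1_card; apply: eq_bigl => x.
  rewrite [x \in part y]inE; case: eqP => [E|]; last by rewrite andbF.
  by rewrite andbT -(top_in_sub _ zS) E.
by move=> x xz; rewrite inE top_in top_in_sub.
Qed.

Lemma card_part_le z : z \in c |: X -> #|part z| <= #|subtree z|.
Proof.
by move=> zS; rewrite (card_subtree_parts zS) (bigD1 z) ?leq_addr //= inE zS mem_sub.
Qed.

Definition kept : {set {set G}} := par_edge @: ~: (c |: X).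

(** Each vertex is joined to its top by kept edges, and the ends of a kept edge
    have the same top. *)
Lemma connect_kept x y : connect (spanning_adj kept) x y = (top x == top y).
Proof.
have ctop u : connect (spanning_adj kept) u (top u).
  elim/rooted_ind: u => [|u uc IH]; first by rewrite top_fix ?setU11.
  case: (boolP (u \in c |: X)) => uS; first by rewrite top_fix.
  rewrite -top_par //; apply: connect_trans IH; apply: connect1.
  by apply/imsetP; exists u; rewrite // inE.
have csym : connect_sym (spanning_adj kept).
  by apply: sym_connect_sym => u v; rewrite /spanning_adj setUC.
apply/idP/eqP => [/connectP [p + ->]|E]; last first.
  by apply: connect_trans (ctop x) _; rewrite E csym ctop.
elim: p x => [//|z p IH] x /= /andP [xz /IH <-].
case/imsetP: xz => u; rewrite inE => uS /set2_eq [] [-> ->].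
  by rewrite top_par.
by rewrite top_par.
Qed.

Lemma mem_kept x : x != c -> (par_edge x \in kept) = (x \notin X).
Proof.
move=> xc; apply/imsetP/idP => [[y + E]|xX]; last first.
  by exists x; rewrite // !inE (negbTE xc).
rewrite !inE negb_or => /andP [yc yX].
by have -> // : x = y; apply: par_edge_inj E; rewrite !inE.
Qed.

Lemma components_kept : components kept = part @: (c |: X).
Proof.
apply/setP => C; apply/imsetP/imsetP => [[x _ ->]|[z zS ->]].
  exists (top x); first exact: top_in.
  by apply/setP => y; rewrite !inE connect_kept eq_sym.
by exists z => //; apply/setP => y; rewrite !inE connect_kept (top_fix zS) eq_sym.
Qed.

Lemma part_inj : {in c |: X &, injective part}.
Proof.
by move=> y z yS zS /setP /(_ y); rewrite !inE top_fix // eqxx => /esym/eqP.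
Qed.

Lemma perm_lambda : perm_eq (lambda kept) [seq #|part z| | z in c |: X].
Proof.
rewrite /lambda perm_sort components_kept /image_mem.
rewrite [[seq #|part z| | z <- _]](map_comp (fun C : {set G} => #|C|) part); apply: perm_map.
apply: uniq_perm; rewrite ?enum_uniq ?map_inj_in_uniq ?enum_uniq //.
  by move=> y z; rewrite !mem_enum; apply: part_inj.
move=> C; rewrite mem_enum; apply/imsetP/mapP => [] [z zS ->]; exists z => //.
  by rewrite mem_enum.
by rewrite mem_enum in zS.
Qed.

Lemma count_lambda (g : pred nat) :
  count g (lambda kept) = #|[set z in c |: X | g #|part z|]|.
Proof.
rewrite (permP perm_lambda) /image_mem count_map -size_filter cardE /enum_mem.
rewrite -filter_predI !size_filter; apply: eq_count => z /=.
by rewrite [RHS]inE andbC.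
Qed.

Lemma size_lambda : size (lambda kept) = #|c |: X|.
Proof. by rewrite (perm_size perm_lambda) size_map -cardE. Qed.

End Cut.

Lemma lambda_count_cut g :
  lambda_count G g = #|[set X : {set G} | (c \notin X) && g (lambda (kept X))]|.
Proof.
have keptK : {in [set X : {set G} | c \notin X] &, injective kept}.
  move=> X Y; rewrite !inE => cX cY E; apply/setP => x.
  case: (eqVneq x c) => [->|xc]; first by rewrite (negbTE cX) (negbTE cY).
  by apply: negb_inj; rewrite -!mem_kept // E.
rewrite /lambda_count -(@card_in_imset _ _ kept); last first.
  by move=> X Y; rewrite !inE => /andP [cX _] /andP [cY _]; apply: keptK; rewrite inE.
apply: eq_card => A; rewrite inE; apply/andP/imsetP => [[AE gA]|[X]].
  have EA : A = kept [set x | (x != c) && (par_edge x \notin A)].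
    apply/setP => e; apply/idP/imsetP => [eA|[x + ->]].
      have := subsetP AE e eA; rewrite edgesE => /imsetP [x].
      by rewrite !inE => xc ex; exists x => //; rewrite !inE (negbTE xc) /= -ex eA.
    by rewrite !inE; case: (x == c) => //=; rewrite negbK.
  by exists [set x | (x != c) && (par_edge x \notin A)]; rewrite ?inE ?eqxx //= -EA.
rewrite inE => /andP [cX gX] ->; split=> //.
rewrite edgesE; apply: imsetS; apply/subsetP => x.
by rewrite !inE negb_or => /andP [].
Qed.

End Rooted.

(** * Rooting a tree, and its centroid *)

Definition other_edge (G : sgraph) (x y : G) : rel G :=
  fun u v => adj u v && ([set u; v] != [set x; y]).

(** A path from [x] to [y] avoiding the edge closes up to a cycle of length at
    least 3. *)
Lemma acyclic_bridge (G : sgraph) (x y : G) :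
  acyclic G -> adj x y -> ~~ connect (other_edge x y) x y.
Proof.
move=> acG xy; apply/negP => /connectP [p /shortenP [q qp uq _] yq].
have sz : size (x :: q) <= 2.
  apply: acG; rewrite /ucycle uq andbT /= rcons_path -yq adj_sym xy andbT.
  by apply: sub_path qp => u v /andP [].
case: q => [|z [|//]] in qp uq yq sz.
  by move: xy; rewrite yq adj_irr.
by move: qp; rewrite /= -[z]yq /other_edge eqxx andbF.
Qed.

Lemma closer_neighbour (G : sgraph) (r : G) :
  (forall x, connect (@adj G) r x) ->
  exists d : G -> nat, forall x, x != r -> exists2 y, adj x y & d y < d x.
Proof.
move=> cG; pose reach x k := [exists p : k.-tuple G, path (@adj G) r p && (last r p == x)].
have reachP x : exists k, reach x k.
  have /connectP [p rp ->] := cG x; exists (size p).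
  by apply/existsP; exists (in_tuple p); rewrite rp eqxx.
exists (fun x => ex_minn (reachP x)) => x xr.
case: ex_minnP => k /existsP [[p /= /eqP <-]] /andP [+ /eqP lx _].
case: (lastP p) lx => [/= rx|q z]; first by rewrite rx eqxx in xr.
rewrite last_rcons rcons_path => -> /andP [rq zx].
exists (last r q); first by rewrite adj_sym.
rewrite size_rcons ltnS; case: ex_minnP => l _; apply.
by apply/existsP; exists (in_tuple q); rewrite rq eqxx.
Qed.

(** Each vertex takes as parent a neighbour closer to [r]. An edge that joins no
    vertex to its parent could be bypassed through [r], against [acyclic_bridge]. *)
Lemma tree_rooted (G : sgraph) (r : G) : tree G -> exists par, rooted r par.
Proof.
case=> _ cG acG; have [d dP] := closer_neighbour (cG r).
have [par parE] : exists par : G -> G, forall x,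
    if x == r then par x = r else adj x (par x) && (d (par x) < d x).
  apply: (fin_all_exists (P := fun x y => if x == r then y = r else
    adj x y && (d y < d x))) => x.
  by case: (eqVneq x r) => [_|/dP [y xy dy]]; [exists r | exists y; rewrite xy].
have par_r : par r = r by have := parE r; rewrite eqxx.
have parP x : x != r -> adj x (par x) && (d (par x) < d x).
  by move=> /negbTE xr; have := parE x; rewrite xr.
have desc (P : G -> Prop) : P r -> (forall x, x != r -> P (par x) -> P x) -> forall x, P x.
  move=> Pr Ps x; have [n] := ubnP (d x); elim: n x => // n IH x dn.
  case: (eqVneq x r) => [-> //|xr]; apply: Ps => //; apply: IH.
  by case/andP: (parP _ xr) => _ dx; apply: leq_trans dx _.
exists par; split=> [|x|x y]; first exact: par_r.
  by elim/desc: x => [|x xr]; [apply: connect0 | apply/connect_trans/fconnect1].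
apply/idP/orP => [xy|[] /andP [nr /eqP <-]]; first last.
- by rewrite adj_sym; case/andP: (parP _ nr).
- by case/andP: (parP _ nr).
apply/orP; apply: contraT; rewrite negb_or !negb_and !negbK => /andP [nx ny].
case/negP: (acyclic_bridge acG xy).
have to_r z : connect (other_edge x y) z r.
  elim/desc: z => [|z zr]; first exact: connect0.
  apply/connect_trans/connect1; rewrite /other_edge; case/andP: (parP _ zr) => -> _ /=.
  apply/eqP => /set2_eq [] [zx pz]; move: nx ny zr; rewrite -?zx -?pz ?eqxx.
    by move=> /orP [->|].
  by move=> _ /orP [->|].
have osym : connect_sym (other_edge x y).
  by apply: sym_connect_sym => u v; rewrite /other_edge adj_sym setUC.
by apply: connect_trans (to_r x) _; rewrite osym.
Qed.

Section SingleCut.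
Variables (G : sgraph) (c : G) (par : G -> G).
Hypothesis rt : rooted c par.

Lemma c_notin_sub z : z != c -> c \notin subtree par z.
Proof. by rewrite inE (fconnect_c rt) eq_sym. Qed.

Lemma top_set1 z u : z != c ->
  top c par [set z] u = if u \in subtree par z then z else c.
Proof.
move=> zc; have zS : z \in c |: [set z] by rewrite !inE eqxx orbT.
have := top_in rt [set z] u; rewrite -(top_in_sub rt u zS) !inE => /orP [] /eqP ->.
  by rewrite (fconnect_c rt) eq_sym (negbTE zc).
by rewrite connect0.
Qed.

Lemma kept_set1 z : z != c -> kept c par [set z] = edges G :\ par_edge par z.
Proof.
move=> zc; rewrite (edgesE rt); apply/setP => e; rewrite in_setD1.
apply/imsetP/andP => [[x + ->]|[ne /imsetP [x + E]]].
  rewrite !inE negb_or => /andP [xc xz]; split.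
    by apply: contra xz => /eqP /(par_edge_inj rt) -> //; rewrite !inE.
  by apply/imsetP; exists x; rewrite ?inE.
rewrite !inE => xc; exists x => //; rewrite !inE negb_or xc /=.
by apply: contraNneq ne => <-; rewrite E.
Qed.

(** Phrased by the edge and not by its lower end, which depends on the root. *)
Lemma connect_without_edge z u w : z != c ->
  connect (spanning_adj (edges G :\ par_edge par z)) u w =
  ((u \in subtree par z) == (w \in subtree par z)).
Proof.
move=> zc; rewrite -kept_set1 // (connect_kept rt) !top_set1 //.
have cz : (c == z) = false by rewrite eq_sym (negbTE zc).
by do 2![case: (_ \in subtree par z)]; rewrite ?eqxx ?(negbTE zc) ?cz.
Qed.

End SingleCut.

(** The sides of an edge do not depend on the root; the subtree below the edge is
    the side that misses the root. *)
Lemma subtree_reroot (G : sgraph) (c c' : G) par par' y :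
  rooted c par -> rooted c' par' -> y != c' ->
  exists2 z, z != c &
    subtree par' y = if c' \in subtree par z then ~: subtree par z else subtree par z.
Proof.
move=> rt rt' yc'; have: par_edge par' y \in edges G.
  by rewrite (edgesE rt') imset_f // !inE.
rewrite (edgesE rt) => /imsetP [z]; rewrite !inE => zc E; exists z => //.
apply/setP => u; have := connect_without_edge rt' u c' yc'.
rewrite E (connect_without_edge rt) // (negbTE (c_notin_sub rt' yc')) eqbF_neg.
by case: ifP => _; rewrite ?in_setC; do 2![case: (u \in _)].
Qed.

(** Take [c] with the smallest subtree among those exceeding half of the tree, for
    an arbitrary root. *)
Lemma centroid (G : sgraph) : tree G ->
  exists c par, rooted c par /\ forall y : G, y != c -> #|subtree par y|.*2 <= #|G|.
Proof.
move=> tG; have [/card_gt0P [r _] _ _] := tG; have [par rt] := tree_rooted r tG.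
have big_r : #|G| < #|subtree par r|.*2.
  rewrite (sub_c rt) cardsT -addnn -[X in X < _]addn0 ltn_add2l.
  by apply/card_gt0P; exists r.
case: (@arg_minnP _ r (fun x => #|G| < #|subtree par x|.*2)
  (fun x => #|subtree par x|) big_r) => c big_c min_c.
have [par' rt'] := tree_rooted c tG; exists c, par'; split=> // y yc.
have [z zr ->] := subtree_reroot rt rt' yc; case: ifP => cz.
  have := subset_leq_card (sub_sub cz); have := cardsC (subtree par z); lia.
rewrite leqNgt; apply/negP => big_z.
have [u uz uc] : exists2 u, u \in subtree par z & u \in subtree par c.
  apply/exists_inP; rewrite -[[exists _ in _, _]]negbK; apply/negP.
  rewrite negb_exists_in => /forall_inP dis.
  have := cardsUI (subtree par z) (subtree par c).
  have -> : subtree par z :&: subtree par c = set0.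
    by apply/setP => u; rewrite !inE; apply/negP => /andP [uz uc];
       have := dis u; rewrite !inE uz uc => /(_ isT).
  have := max_card (subtree par z :|: subtree par c); rewrite cards0; lia.
rewrite !inE in uz uc; case/orP: (fconnect_total rt uz uc) => h; last by rewrite inE h in cz.
have zc : z != c by apply: contraFneq cz => ->; rewrite mem_sub.
have := card_sub_lt rt (z := c) (x := z); rewrite inE h zc => /(_ isT isT).
by rewrite ltnNge min_c.
Qed.

(** * Isomorphism from labels, and binomial sums *)

Definition kids (G : sgraph) (c : G) (par : G -> G) (L : eqType) (lab : G -> L)
    (x : G) (a : L) : {set G} :=
  [set z | child c par x z && (lab z == a)].

Section LabelIso.
Variables (G H : sgraph) (c : G) (par : G -> G) (c' : H) (par' : H -> H).
Variables (L : eqType) (lab : G -> L) (lab' : H -> L).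
Hypotheses (rt : rooted c par) (rt' : rooted c' par').

Local Notation kidsG := (kids c par lab).
Local Notation kidsH := (kids c' par' lab').

Hypothesis lab_root : lab c = lab' c'.
Hypothesis card_kids : forall x y a, lab x = lab' y -> #|kidsG x a| = #|kidsH y a|.

(** [x] is sent to a child of the image of its parent, namely to the one with the
    same label as [x] and the same rank among the children of that label. The
    recursion is on a bound for the depth of [x]. *)
Fixpoint lift_iso (k : nat) (x : G) : H :=
  if k is k'.+1 then
    if x == c then c' else
    nth c' (enum (kidsH (lift_iso k' (par x)) (lab x)))
      (index x (enum (kidsG (par x) (lab x))))
  else c'.

Lemma lift_iso_stable k x : iter k par x = c -> lift_iso k.+1 x = lift_iso k x.
Proof.
elim: k x => [x /= ->|k IH x]; first by rewrite eqxx.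
by rewrite iterSr => /IH /= ->.
Qed.

Lemma label_map : exists f : G -> H, f c = c' /\
  forall x, x != c -> f x =
    nth c' (enum (kidsH (f (par x)) (lab x))) (index x (enum (kidsG (par x) (lab x)))).
Proof.
have [_ cP _] := rt.
exists (lift_iso #|G|.+1); split=> [|x xc]; first by rewrite /= eqxx.
rewrite [LHS]/= (negbTE xc); congr (nth _ (enum (kidsH _ _)) _).
symmetry; apply: lift_iso_stable.
have /iter_findex := cP (par x).
have lt : findex par (par x) c <= #|G|.
  by apply: leq_trans (ltnW (findex_max (cP _))) _; apply: max_card.
rewrite -(subnK lt) iterD => ->; apply: iter_fix; by case: rt.
Qed.

(** If the label of a vertex determines how many children of each label it has,
    the label of the root determines the rooted tree. *)
Lemma label_iso : #|G| = #|H| -> isomorphic G H.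
Proof.
move=> cardGH; have [f [fc fE]] := label_map.
have f_kids x : x != c -> lab (par x) = lab' (f (par x)) -> f x \in kidsH (f (par x)) (lab x).
  move=> xc E; rewrite -mem_enum (fE _ xc); apply: mem_nth.
  by rewrite -cardE -(card_kids _ E) cardE index_mem mem_enum inE /child xc !eqxx.
have f_lab x : lab x = lab' (f x).
  elim/(rooted_ind rt): x => [|x xc IH]; first by rewrite fc.
  by have := f_kids _ xc IH; rewrite inE => /andP [_ /eqP].
have f_child x : x != c -> child c' par' (f (par x)) (f x).
  by move=> xc; have := f_kids _ xc (f_lab _); rewrite inE => /andP [].
have f_root x : (f x == c') = (x == c).
  case: (eqVneq x c) => [->|xc]; first by rewrite fc eqxx.
  by apply/negbTE; case/andP: (f_child _ xc).
have f_inj : injective f.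
  elim/(rooted_ind rt) => [y|x xc IH y].
    by move/esym/eqP; rewrite fc f_root => /eqP.
  move=> E; have yc : y != c by rewrite -f_root -E f_root.
  have Ep : par x = par y.
    apply: IH; case/andP: (f_child _ xc) => _ /eqP <-.
    by rewrite E; case/andP: (f_child _ yc) => _ /eqP.
  have El : lab x = lab y by rewrite !f_lab E.
  have mem z : z != c -> z \in enum (kidsG (par z) (lab z)).
    by move=> zc; rewrite mem_enum inE /child zc !eqxx.
  move: E; rewrite (fE _ xc) (fE _ yc) Ep El => /eqP.
  rewrite nth_uniq ?enum_uniq // -?cardE -?(card_kids _ (f_lab _)) ?cardE ?index_mem ?mem //.
    by move/eqP; apply: (index_inj y); rewrite ?mem // -Ep -El mem.
  by rewrite -Ep -El mem.
exists f; first exact: inj_card_bij f_inj (eq_leq (esym cardGH)).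
have [_ _ adjE] := rt; have [_ _ adjE'] := rt'.
have half x y : (f x != c') && (par' (f x) == f y) = (x != c) && (par x == y).
  rewrite f_root; case: (eqVneq x c) => //= xc.
  by case/andP: (f_child _ xc) => _ /eqP ->; rewrite (inj_eq f_inj).
by move=> x y; rewrite adjE adjE' !half.
Qed.

End LabelIso.

(** The matrix of the binomial coefficients (l choose k) is unitriangular: the
    number of [i] with [f i = k] is found by downward induction on [k]. *)
Lemma binomial_sums_determine (I J : finType) (A : {set I}) (B : {set J})
    (f : I -> nat) (g : J -> nat) (N : nat) :
  (forall i, i \in A -> f i <= N) -> (forall j, j \in B -> g j <= N) ->
  (forall k, \sum_(i in A) 'C(f i, k) = \sum_(j in B) 'C(g j, k)) ->
  forall k, #|[set i in A | f i == k]| = #|[set j in B | g j == k]|.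
Proof.
move=> fN gN E.
have sumE (K : finType) (C : {set K}) (h : K -> nat) k : (forall i, i \in C -> h i <= N) ->
    \sum_(i in C) 'C(h i, k) =
    \sum_(l < N.+1 | k <= l) #|[set i in C | h i == l]| * 'C(l, k).
  move=> hN; have hlt i : i \in C -> h i < N.+1 by move=> /hN; rewrite ltnS.
  rewrite [RHS]big_mkcond (partition_big (fun i => inord (h i) : 'I_N.+1) predT) //=.
  apply: eq_bigr => l _; rewrite (eq_bigr (fun=> 'C(l, k))); last first.
    by move=> i /andP [iC /eqP <-]; rewrite inordK ?hlt.
  rewrite sum_nat_const; case: leqP => [_|/bin_small ->]; last by rewrite muln0.
  congr (_ * _); apply: eq_card => i; rewrite inE unfold_in.
  by case: (boolP (i \in C)) => //= iC; rewrite -val_eqE /= inordK ?hlt.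
move=> k; case: (leqP k N) => [kN|Nk]; last first.
  rewrite !eq_card0 // => i; rewrite inE; apply/negP => /andP [iA /eqP ik].
    by have := gN _ iA; lia.
  by have := fN _ iA; lia.
have [d] := ubnP (N - k); elim: d k kN => // d IH k kN dk.
have kN' : k < N.+1 by [].
have := E k; rewrite (sumE _ _ _ _ fN) (sumE _ _ _ _ gN).
rewrite [LHS](bigD1 (Ordinal kN')) ?leqnn // [RHS](bigD1 (Ordinal kN')) ?leqnn //=.
rewrite binn !muln1.
set S := (X in _ + X = _); set S' := (X in _ = _ + X); suff -> : S = S' by move/addIn.
apply: eq_bigr => l /andP [kl]; rewrite -val_eqE /= => lk.
by have lN := ltn_ord l; congr (_ * _); apply: IH; lia.
Qed.

(** * The rooted shape of a PTE-tree *)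

Lemma same_size_eq (G : sgraph) (c : G) par x y u : rooted c par ->
  #|subtree par x| = #|subtree par y| -> u \in subtree par x -> u \in subtree par y -> x = y.
Proof.
move=> rt E; rewrite !inE => ux uy; apply/eqP; apply: contraT => ne.
case/orP: (fconnect_total rt ux uy) => h.
  by have := card_sub_lt rt (z := y) (x := x); rewrite inE h ne => /(_ isT isT); lia.
by have := card_sub_lt rt (z := x) (x := y); rewrite inE h eq_sym ne => /(_ isT isT); lia.
Qed.

(** The subtrees below the elements of [D] are disjoint, having the same size, so
    counting shows that they cover the complement of [B]. *)
Lemma sub_cover (G : sgraph) (c : G) par (D B : {set G}) k :
  rooted c par -> {in D, forall x, #|subtree par x| = k} ->
  {in D & B, forall x u, u \notin subtree par x} -> #|D| * k = #|~: B| ->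
  forall u, u \notin B -> exists2 x, x \in D & u \in subtree par x.
Proof.
move=> rt Dk DB cardDB; pose K := [set u | [exists x in D, u \in subtree par x]].
have uniqD x y u : x \in D -> y \in D -> u \in subtree par x -> u \in subtree par y -> x = y.
  by move=> xD yD; apply: same_size_eq rt _; rewrite !Dk.
have KB : K \subset ~: B.
  apply/subsetP => u; rewrite !inE => /exists_inP [x xD ux].
  by apply: contraL ux => uB; apply: DB.
have cardK : #|K| = #|D| * k.
  rewrite -sum_nat_const (eq_bigr (fun x => \sum_(u in subtree par x) 1)); last first.
    by move=> x xD; rewrite sum1_card Dk.
  rewrite (exchange_big_dep (mem K)) /= => [|x u xD ux]; last first.
    by rewrite inE; apply/exists_inP; exists x.
  rewrite -sum1_card; apply: eq_bigr => u; rewrite inE => /exists_inP [x xD ux].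
  by rewrite (big_pred1 x) // => y /=; apply/andP/eqP => [[yD uy]|-> //]; apply: uniqD uy ux.
have /eqP KE : K == ~: B by rewrite eqEcard KB cardK cardDB leqnn.
move=> u uB; have : u \in K by rewrite KE inE.
by rewrite inE => /exists_inP.
Qed.

Lemma sum_mem_card (T : finType) (A B : {set T}) :
  \sum_(x in A) (x \in B) = #|A :&: B|.
Proof.
rewrite -sum1_card [LHS]big_mkcond [RHS]big_mkcond; apply: eq_bigr => x _.
by rewrite inE; case: (x \in A); case: (x \in B).
Qed.

Lemma card_sep3 (T : finType) (S : {set T}) (F : T -> nat) (a b d : nat) :
  a != b -> a != d -> b != d ->
  #|[set z in S | F z == a]| + #|[set z in S | F z == b]| +
    #|[set z in S | F z == d]| = #|S| ->
  {in S, forall z, F z \in [:: a; b; d]}.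
Proof.
move=> ab ad bd E z zS; rewrite !inE; apply: contraT => nz.
have sep k : #|[set z in S | F z == k]| = \sum_(x in S) (F x == k).
  rewrite -sum1_card [LHS]big_mkcond [RHS]big_mkcond; apply: eq_bigr => x _.
  by rewrite inE; case: (x \in S); case: eqP.
have := E; rewrite !sep -!big_split (big_setD1 z) //= (cardsD1 z) zS.
have : \sum_(i in S :\ z) ((F i == a) + (F i == b) + (F i == d)) <= #|S :\ z|.
  rewrite -sum1_card; apply: leq_sum => x _.
  case: (eqVneq (F x) a) => [->|_]; first by rewrite (negbTE ab) (negbTE ad).
  by case: (eqVneq (F x) b) => [->|_]; [rewrite (negbTE bd) | case: eqP].
move: nz; case: eqP => // _; case: eqP => // _; case: eqP => // _ _; lia.
Qed.

Definition of_size (G : sgraph) (par : G -> G) k := [set x | #|subtree par x| == k].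

(** The rooted shape of T_alpha(p), expressed by subtree sizes only, because these
    are what the polynomial U controls. Here [n] is the number of branches. *)
Record pte_rooted (alpha n : nat) (G : sgraph) (c : G) (par : G -> G) : Prop :=
  PteRooted {
  pte_rt : rooted c par;
  pte_n : 2 <= n;
  pte_alpha : 0 < alpha;
  pte_card : #|G| = (n * (3 * alpha).+1).+1;
  pte_size : forall x, x != c -> #|subtree par x| \in [:: 1; 2; 3; (3 * alpha).+1];
  pte_branches : #|of_size par (3 * alpha).+1| = n;
  pte_legs : #|of_size par 3| = n * alpha }.

(** A leg contains a subtree of size 2 exactly when it is a path leg; so below the
    root of a branch this set counts the path legs. *)
Definition size2_below (G : sgraph) (par : G -> G) x := subtree par x :&: of_size par 2.

(** All branches but one are detached ([n.-1] parts of size m = 3 alpha + 1), and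
    [j] path legs of the last one lose their middle edge, which leaves a part of
    size 1 + m - 2 j around the root. *)
Definition path_cut_stat (alpha n j : nat) : pred (seq nat) := fun l =>
  [&& size l == n + j, count_mem (3 * alpha).+1 l == n.-1,
      count_mem ((3 * alpha).+2 - j.*2) l == 1 & count_mem 2 l == j].

Section Structure.
Variables (alpha n : nat) (G : sgraph) (c : G) (par : G -> G).
Hypothesis H : pte_rooted alpha n c par.

Let rt := pte_rt H.
Let m := (3 * alpha).+1.
Let V := of_size par m.

Let m_gt3 : 3 < m. Proof. by have := pte_alpha H; rewrite /m; lia. Qed.
Let cardV : #|V| = n. Proof. exact: pte_branches H. Qed.
Let size_c : #|subtree par c| = (n * m).+1.
Proof. by rewrite (sub_c rt) cardsT (pte_card H). Qed.
Let m_lt_c : m < #|subtree par c|.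
Proof. by rewrite size_c ltnS leq_pmull //; have := pte_n H; lia. Qed.
Let cV : c \notin V. Proof. by rewrite inE; lia. Qed.

Lemma size_le_m x : x != c -> #|subtree par x| <= m.
Proof. by move=> /(pte_size H); rewrite !inE -/m => /or4P [] /eqP ->; lia. Qed.

Lemma branch_above u : u != c -> exists2 v, v \in V & u \in subtree par v.
Proof.
move=> uc; apply: (@sub_cover G c par V [set c] m) => //; last by rewrite inE.
- by move=> x; rewrite inE => /eqP.
- move=> x y xV; rewrite inE => /eqP ->; rewrite inE (fconnect_c rt).
  by apply: contraTneq xV => <-.
- by rewrite cardV cardsC1 (pte_card H).
Qed.

(** The subtrees of size m cover all vertices but the root, so a child of the root
    lies in one of them. *)
Lemma branchE v : (v \in V) = child c par c v.
Proof.
apply/idP/andP => [vV|[vc /eqP pv]].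
  have vc : v != c by apply: contraTneq vV => ->.
  split=> //; apply: contraT => pc; have := card_sub_par rt vc.
  by have := size_le_m pc; move: vV; rewrite inE => /eqP ->; lia.
have [u uV] := branch_above vc; rewrite inE (fconnect_parE rt) pv (fconnect_c rt).
case/orP => [/eqP -> //|/andP [_ /eqP cu]].
by rewrite -cu (negbTE cV) in uV.
Qed.

(** The subtrees of size 3 cover all vertices but the root and the roots of the
    branches. *)
Lemma leg_of_branch v y : v \in V -> child c par v y -> #|subtree par y| = 3.
Proof.
move=> vV /andP [yc /eqP pv].
have vc : v != c by apply: contraTneq vV => ->.
have yV : y \notin V by rewrite branchE /child yc pv.
have cov u : u \notin c |: V -> exists2 w, w \in of_size par 3 & u \in subtree par w.
  apply: (@sub_cover G c par (of_size par 3) (c |: V) 3) => //.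
  - by move=> x; rewrite inE => /eqP.
  - move=> x w; rewrite !inE => /eqP x3 /orP [/eqP ->|/eqP wm].
      rewrite (fconnect_c rt); apply: contraTneq m_lt_c => ->.
      by rewrite x3; lia.
    apply/negP => wx; have := subset_leq_card (sub_sub (par := par) (x := w) (z := x) _).
    by rewrite inE wx wm x3 => /(_ isT); lia.
  - rewrite (pte_legs H); have := cardsC (c |: V).
    rewrite cardsU1 cV cardV (pte_card H) add1n /m; lia.
have [|w] := cov y; first by rewrite in_setU1 negb_or yc.
rewrite inE => /eqP w3; rewrite inE (fconnect_parE rt) pv => /orP [/eqP -> //|/andP [_ h]].
have := subset_leq_card (sub_sub (par := par) (x := v) (z := w) _).
rewrite inE h w3 => /(_ isT); move: vV; rewrite inE => /eqP ->; lia.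
Qed.

(* counting *)
Section Count.
Variable j : nat.
Hypothesis j_small : j.*2 + 2 < m.
Let M := m.+1 - j.*2.

Let mM : m != M. Proof. by apply/eqP; rewrite /M; lia. Qed.
Let m2 : m != 2. Proof. by lia. Qed.
Let M2 : M != 2. Proof. by rewrite /M; lia. Qed.

Section Good.
Variable X : {set G}.
Let S := c |: X.
Let F z := #|part c par X z|.

(** All parts have size m, M = m + 1 - 2 j or 2. A part whose top is not the root
    of the tree or of a branch has at most 3 vertices, hence 2, and its top has
    subtree size 2 since a subtree made of parts of size 2 has even size. If all
    branches were detached, the part of the root would have size 1; so one branch
    [v] is attached, and only one because at most [j] parts are not topped by the
    root of the tree or of a branch. In a detached branch, parity excludes a top
    part of size M, so the parts of size 2 all lie in [v]. *)
Lemma path_cut_form : c \notin X -> path_cut_stat alpha n j (lambda (kept c par X)) ->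
  exists v (Z : {set G}),
    [/\ v \in V, Z \subset size2_below par v, #|Z| = j & X = (V :\ v) :|: Z].
Proof.
move=> cX /and4P []; rewrite (size_lambda rt) !(count_lambda rt) -/m -/M -/S.
move=> /eqP cardS /eqP cardm /eqP cardM /eqP card2.
have n2 := pte_n H.
have Fin : {in S, forall z, F z \in [:: m; M; 2]}.
  by apply: card_sep3 => //; rewrite cardm cardM card2 cardS; lia.
have neqc z : z \in X -> z != c by move=> zX; apply: contraNneq cX => <-.
have XS z : z \in X -> z \in S by move=> zX; rewrite !inE zX orbT.
have small z : z \in X -> #|subtree par z| <= 3 -> F z = 2.
  move=> zX z3; have := card_part_le rt (XS _ zX); rewrite -/(F z).
  by have := Fin _ (XS _ zX); rewrite !inE => /or3P [] /eqP -> //; rewrite /M; lia.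
have notV z : z \in X -> z \notin V -> #|subtree par z| <= 3.
  move=> zX; have := pte_size H (neqc _ zX); rewrite !inE -/m.
  by case/or4P => /eqP ->; rewrite ?eqxx.
pose Z := X :\: V.
have Z2 z : z \in Z -> #|subtree par z| = 2.
  move=> /setDP [zX zV]; have z3 := notV _ zX zV.
  have := card_subtree_parts rt (XS _ zX); rewrite (eq_bigr (fun=> 2)); last first.
    move=> x /setIP [xS xz]; have x3 : #|subtree par x| <= 3.
      exact: leq_trans (subset_leq_card (sub_sub xz)) z3.
    apply: small => //; move: xS; rewrite !inE => /orP [/eqP xc|//].
    by move: x3; rewrite xc; lia.
  rewrite sum_nat_const; have := pte_size H (neqc _ zX).
  by rewrite !inE -/m; move: z3 => /[swap] /or4P [] /eqP ->; lia.
have [v /setDP [vV vX]] : exists v, v \in V :\: X.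
  apply/set0Pn; apply: contraTneq (Fin c (setU11 _ _)) => VX0.
  suff -> : F c = 1 by rewrite !inE /M; lia.
  rewrite /F; apply/eqP/cards1P; exists c; apply/setP => x; rewrite !inE.
  apply/eqP/eqP => [tx|->]; last by rewrite top_fix ?setU11.
  apply/eqP; apply: contraT => xc; have [w wV xw] := branch_above xc.
  have wX : w \in X.
    apply: contraT => wX; have : w \in V :\: X by rewrite in_setD wX.
    by rewrite VX0 inE.
  have := top_in_sub rt x (XS _ wX); rewrite tx xw inE (fconnect_c rt) => /eqP cw.
  by rewrite -cw (negbTE cX) in wX.
have ZA2 : Z \subset [set z in S | F z == 2].
  apply/subsetP => z /setDP [zX zV]; rewrite inE XS //= small //; exact: notV.
have cardZ : #|Z| <= j by rewrite -card2; apply: subset_leq_card.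
have cardX : #|X :&: V| + #|Z| = (n + j).-1.
  by rewrite cardsID; have := cardS; rewrite /S cardsU1 cX; lia.
have XVv : X :&: V \subset V :\ v.
  by apply/subsetP => x /setIP [xX xV]; rewrite in_setD1 xV andbT; apply: contraNneq vX => <-.
have cardVv : #|V :\ v| = n.-1 by have := cardsD1 v V; rewrite vV cardV; lia.
have cardXV : #|X :&: V| <= n.-1 by rewrite -cardVv; apply: subset_leq_card.
have /eqP XVE : X :&: V == V :\ v by rewrite eqEcard XVv cardVv; lia.
have cardZj : #|Z| = j by lia.
have /eqP ZE : Z == [set z in S | F z == 2] by rewrite eqEcard ZA2 card2; lia.
have ZsubV y z : y \in X :&: V -> z \in Z -> z \notin subtree par y.
  move=> yXV zZ; have /setIP [yX yV] := yXV.
  have := card_subtree_parts rt (XS _ yX); rewrite -/S (big_setD1 y); last first.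
    by rewrite inE XS // mem_sub.
  have -> : (S :&: subtree par y) :\ y = Z :&: subtree par y.
    apply/setP => x; rewrite in_setD1 in_setI [in RHS]in_setI in_setD.
    case: (boolP (x \in subtree par y)) => xy; rewrite ?andbF // !andbT.
    have xc : x != c.
      by apply: contraTneq xy => ->; rewrite inE (fconnect_c rt) eq_sym neqc.
    rewrite /S in_setU1 (negbTE xc) /=.
    case: (boolP (x \in X)) => xX; rewrite ?andbF // !andbT.
    apply/idP/idP => [xy'|xV].
      apply: contra xy' => xV; apply/eqP; apply: (same_size_eq rt _ (mem_sub _ x) xy).
      by move: xV yV; rewrite !inE => /eqP -> /eqP ->.
    by apply: contraNneq xV => ->.
  rewrite (eq_bigr (fun=> 2)); last first.
    by move=> x /setIP [+ _]; rewrite ZE inE => /andP [_ /eqP].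
  rewrite sum_nat_const -/(F y) => sumy.
  have : F y != 2.
    apply/eqP => Fy; have : y \in Z by rewrite ZE inE XS // Fy eqxx.
    by rewrite inE yV.
  have := Fin _ (XS _ yX); rewrite !inE => Fy Fy2.
  have card0 : #|Z :&: subtree par y| = 0.
    move: yV sumy Fy Fy2; rewrite inE => /eqP ->; clear -j_small.
    move: (F y) #|_| => a b; rewrite /M; move: m j_small => m0 ? /= E.
    by case/or3P => /eqP a_eq; rewrite a_eq in E *; lia.
  apply/negP => zy; have : z \in Z :&: subtree par y by rewrite in_setI zZ inE.
  by rewrite (cards0_eq card0) inE.
exists v, Z; split=> //; last by rewrite -XVE setID.
apply/subsetP => z zZ; rewrite in_setI [z \in of_size _ _]inE Z2 // andbT.
have /setDP [zX _] := zZ; have [w wV zw] := branch_above (neqc _ zX).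
case: (eqVneq w v) zw => [-> //|wv zw].
have : w \in X :&: V by rewrite XVE in_setD1 wv.
by move=> /ZsubV /(_ zZ); rewrite zw.
Qed.

End Good.

(** The parts are found from the leaves of the tree upwards, the part of the root
    having what is left of the vertices. *)
Lemma path_cut_formK v (Z : {set G}) : v \in V -> Z \subset size2_below par v -> #|Z| = j ->
  (c \notin V :\ v :|: Z) && path_cut_stat alpha n j (lambda (kept c par (V :\ v :|: Z))).
Proof.
move=> vV Zv cardZ; set X := V :\ v :|: Z; have n2 := pte_n H.
have Z2 z : z \in Z -> #|subtree par z| = 2.
  by move=> /(subsetP Zv); rewrite !inE => /andP [_ /eqP].
have Zsub z : z \in Z -> z \in subtree par v.
  by move=> /(subsetP Zv) /setIP [].
have Vm z : z \in V -> #|subtree par z| = m by rewrite inE => /eqP.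
have cX : c \notin X.
  apply/negP; rewrite in_setU in_setD1 (negbTE cV) andbF /= => /Z2.
  by rewrite size_c; lia.
rewrite cX /=; pose S := c |: X; pose F z := #|part c par X z|.
have SP z : z \in S -> [\/ z = c, z \in V :\ v | z \in Z].
  rewrite in_setU1 in_setU => /or3P [/eqP|?|?]; [exact: Or31 | exact: Or32 | exact: Or33].
have leaf_fib z : z \in S -> (forall x, x \in S -> x \in subtree par z -> x = z) ->
    F z = #|subtree par z|.
  move=> zS only; rewrite (card_subtree_parts rt zS) (big_pred1 z) // => x /=.
  apply/setIP/eqP => [[xS xz]|->]; first exact: only.
  by rewrite zS mem_sub.
have FZ z : z \in Z -> F z = 2.
  move=> zZ; rewrite leaf_fib ?Z2 //; first by rewrite !inE zZ !orbT.
  move=> x xS xz; apply/eqP; apply: contraT => ne.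
  have := card_sub_lt rt xz ne; rewrite (Z2 z zZ).
  case: (SP _ xS) => [->|/setD1P [_ /Vm ->]|/Z2 ->]; rewrite ?size_c; lia.
have FV y : y \in V :\ v -> F y = m.
  move=> yV; have /setD1P [yv yV'] := yV.
  rewrite leaf_fib ?Vm //; first by rewrite 2!in_setU yV orbT.
  move=> x xS xy; case: (SP _ xS) => [xc|/setD1P [_ xV]|xZ].
  - by have := subset_leq_card (sub_sub xy); rewrite xc leqNgt (Vm y yV') m_lt_c.
  - by apply: (same_size_eq rt _ (mem_sub par x) xy); rewrite !Vm.
  - have E : y = v by apply: (same_size_eq rt _ xy (Zsub _ xZ)); rewrite !Vm.
    by rewrite E eqxx in yv.
have cardVv : #|V :\ v| = n.-1 by have := cardsD1 v V; rewrite vV cardV; lia.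
have dis : [disjoint V :\ v & Z].
  rewrite disjoint_subset; apply/subsetP => z /setD1P [_ zV]; rewrite inE.
  by apply/negP => /Z2; rewrite Vm //; lia.
have sumX (f : G -> nat) : \sum_(z in X) f z = \sum_(z in V :\ v) f z + \sum_(z in Z) f z.
  by rewrite -bigU //=; apply: eq_bigl => z; apply: in_setU.
have Fc : F c = M.
  have := card_subtree_parts rt (setU11 c X); rewrite (sub_c rt) setIT big_setU1 //= sumX.
  rewrite (eq_bigr _ FV) (eq_bigr _ FZ) !sum_nat_const cardVv cardZ cardsT (pte_card H) -/m.
  have -> : (n * m).+1 = (n.-1 * m + m).+1 by case: (n) n2 => // n' _; rewrite mulSn addnC.
  by rewrite /F /M; lia.
have cardX : #|X| = n.-1 + j by rewrite -sum1_card sumX !sum1_card cardVv cardZ.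
have sep k : #|[set z in S | F z == k]| = (M == k) + n.-1 * (m == k) + j * (2 == k).
  rewrite -sum1_card [LHS]big_mkcond /=.
  rewrite (eq_bigr (fun z => if z \in S then (F z == k : nat) else 0)); last first.
    by move=> z _; rewrite inE; case: (z \in S); case: eqP.
  rewrite -big_mkcond big_setU1 //= sumX Fc addnA.
  rewrite (eq_bigr (fun=> (m == k : nat))) => [|z /FV -> //].
  rewrite [X in _ + X](eq_bigr (fun=> (2 == k : nat))) => [|z /FZ -> //].
  by rewrite !sum_nat_const cardVv cardZ.
rewrite /path_cut_stat (size_lambda rt) !(count_lambda rt) -/m -/M !sep cardsU1 cX cardX.
have [Mm twom twoM] : [/\ M != m, 2 != m & 2 != M] 
  by split; rewrite eq_sym.
rewrite !eqxx (negbTE mM) (negbTE m2) (negbTE M2) (negbTE Mm) (negbTE twom) (negbTE twoM).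
apply/and4P; split; lia.
Qed.

(** An edge set as in [path_cut_form] leaves exactly one branch attached, and is
    then given by [j] of the path legs of this branch. *)
Lemma lambda_count_path_cut :
  lambda_count G (path_cut_stat alpha n j) = \sum_(v in V) 'C(#|size2_below par v|, j).
Proof.
rewrite (lambda_count_cut rt); set good := [set X | _].
have goodP X : X \in good -> exists v (Z : {set G}),
    [/\ v \in V, Z \subset size2_below par v, #|Z| = j & X = (V :\ v) :|: Z].
  by rewrite inE => /andP [cX /(path_cut_form cX)].
have notZ v (Z : {set G}) z : Z \subset size2_below par v -> z \in V -> z \notin Z.
  move=> Zv zV; apply: contraL zV => /(subsetP Zv); rewrite !inE => /andP [_ /eqP ->].
  by lia.
have missing X : X \in good -> \sum_(v in V) (v \notin X) = 1.
  case/goodP => v [Z [vV Zv _ ->]]; rewrite (big_setD1 v) //= big1 => [|w wV].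
    by rewrite !inE eqxx /= (negbTE (notZ _ _ _ Zv vV)).
  by rewrite in_setU wV.
rewrite -sum1_card (eq_bigr (fun X : {set G} => \sum_(v in V) (v \notin X))); last first.
  by move=> X /missing.
rewrite exchange_big; apply: eq_bigr => v vV /=.
rewrite -cards_draws.
have injV : {in [set Z : {set G} | Z \subset size2_below par v & #|Z| == j] &,
             injective (fun Z => (V :\ v) :|: Z)}.
  move=> Z Z'; rewrite !inE => /andP [Zv _] /andP [Zv' _] /setP E; apply/setP => z.
  have := E z; rewrite !in_setU; case: (boolP (z \in V :\ v)) => //= /setD1P [_ zV].
  by rewrite (negbTE (notZ _ _ _ Zv zV)) (negbTE (notZ _ _ _ Zv' zV)).
rewrite -(card_in_imset injV) -sum1_card big_mkcond [RHS]big_mkcond /=.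
apply: eq_bigr => X _; case: (boolP (X \in good)) => Xg.
  have [w [Z [wV Zw cardZ XE]]] := goodP _ Xg.
  case: (boolP (v \in X)) => vX.
    rewrite ifF //; apply/negP => /imsetP [Z' ]; rewrite inE => /andP [Zv' _] E.
    by move: vX; rewrite E in_setU in_setD1 eqxx /= (negbTE (notZ _ _ _ Zv' vV)).
  rewrite ifT //; have vw : v = w.
    by apply/eqP; apply: contraNT vX => vw; rewrite XE in_setU in_setD1 vw vV.
  by apply/imsetP; exists Z; rewrite vw //; rewrite inE Zw cardZ eqxx.
rewrite ifF //; apply/negP => /imsetP [Z]; rewrite inE => /andP [Zv /eqP cardZ] XE.
by move: Xg; rewrite inE XE path_cut_formK.
Qed.

End Count.
End Structure.

(** * Labels determine a PTE-tree *)

Definition label (G : sgraph) (par : G -> G) (x : G) : nat * nat :=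
  (#|subtree par x|, #|size2_below par x|).

Section Labels.
Variables (G : sgraph) (c : G) (par : G -> G).
Hypothesis rt : rooted c par.
Let lab := label par.
Let kid := kids c par lab.

Lemma card_size2_belowE z :
  #|size2_below par z| =
    (#|subtree par z| == 2) + \sum_(y | child c par z y) #|size2_below par y|.
Proof.
rewrite /size2_below -sum_mem_card (sum_sub rt) inE; congr (_ + _).
by apply: eq_bigr => y _; rewrite sum_mem_card.
Qed.

Lemma sum_kids (f : nat * nat -> nat) (s : seq (nat * nat)) x : uniq s ->
  (forall y, child c par x y -> lab y \in s) ->
  \sum_(y | child c par x y) f (lab y) = \sum_(a <- s) #|kid x a| * f a.
Proof.
move=> us ys; rewrite (eq_bigr (fun y => \sum_(a <- s) (lab y == a) * f a)); last first.
  move=> y /ys yin; rewrite (bigD1_seq _ yin us) /= eqxx mul1n big1 ?addn0 // => a.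
  by rewrite eq_sym => /negbTE ->.
rewrite exchange_big; apply: eq_bigr => a _ /=; rewrite -big_distrl /=; congr (_ * _).
rewrite -sum1_card big_mkcond [RHS]big_mkcond /=; apply: eq_bigr => y _.
by rewrite inE; case: (child c par x y); case: eqP.
Qed.

Lemma kids0 (s : seq (nat * nat)) x a :
  (forall y, child c par x y -> lab y \in s) -> a \notin s -> #|kid x a| = 0.
Proof.
move=> ys as_; apply: eq_card0 => y; rewrite inE; apply/negP => /andP [/ys + /eqP E].
by rewrite E (negbTE as_).
Qed.

Lemma card_sub_child x y : child c par x y -> #|subtree par y| < #|subtree par x|.
Proof. by move=> /andP [yc /eqP <-]; exact: (card_sub_par rt yc). Qed.

Lemma card_sub_gt0 x : 0 < #|subtree par x|.
Proof. by apply/card_gt0P; exists x; apply: mem_sub. Qed.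

Lemma small_label x : #|subtree par x| <= 2 -> lab x \in [:: (1, 0); (2, 1)].
Proof.
have label1 z : #|subtree par z| = 1 -> #|size2_below par z| = 0.
  move=> z1; have := card_subE rt z; rewrite z1 => -[] sum0.
  rewrite card_size2_belowE z1 /= big1 // => y yz; have := card_sub_child yz.
  by rewrite z1; have := card_sub_gt0 y; lia.
move=> x2; have x0 := card_sub_gt0 x.
have [x1|{x0}x2'] : #|subtree par x| = 1 \/ #|subtree par x| = 2 by lia.
  by rewrite /lab /label x1 label1.
rewrite /lab /label card_size2_belowE x2' /= big1 // => y yx; apply: label1.
by have := card_sub_child yx; have := card_sub_gt0 y; lia.
Qed.

(** All children are labelled [(1, 0)] or [(2, 1)]; counting their vertices, and
    their subtrees of size 2, gives one linear equation each. *)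
Lemma kids_small x : #|subtree par x| <= 3 ->
  [/\ #|subtree par x| = (#|kid x (1, 0)| + #|kid x (2, 1)| * 2).+1,
      #|size2_below par x| = (#|subtree par x| == 2) + #|kid x (2, 1)| &
      forall a, a \notin [:: (1, 0); (2, 1)] -> #|kid x a| = 0].
Proof.
move=> x3; have ys y : child c par x y -> lab y \in [:: (1, 0); (2, 1)].
  by move=> yx; apply: small_label; have := card_sub_child yx; lia.
split; last by move=> a; apply: kids0.
- rewrite (card_subE rt) (sum_kids (fun a => a.1) _ ys) // !big_cons big_nil /=; lia.
- by rewrite card_size2_belowE (sum_kids (fun a => a.2) _ ys) // !big_cons big_nil /=; lia.
Qed.

End Labels.

(** The number of children labelled [a] of a vertex labelled [l] that is not the
    root. For a label [(s, q)] with [s <= 3] there are [q - (s == 2)] children of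
    size 2, and children of size 1 fill the rest; the root of a branch has [q]
    path legs, labelled [(3, 1)], and [alpha - q] star legs, labelled [(3, 0)]. *)
Definition kids_of_label (alpha : nat) (l a : nat * nat) : nat :=
  let: (s, q) := l in
  if s <= 3 then
    if a == (1, 0) then s.-1 - (q - (s == 2)).*2
    else if a == (2, 1) then q - (s == 2) else 0
  else if a == (3, 0) then alpha - q else if a == (3, 1) then q else 0.

Section PteLabels.
Variables (alpha n : nat) (G : sgraph) (c : G) (par : G -> G).
Hypothesis H : pte_rooted alpha n c par.
Let rt := pte_rt H.
Let m := (3 * alpha).+1.
Let V := of_size par m.
Let lab := label par.
Let kid := kids c par lab.

Lemma kids_branch v : v \in V ->
  [/\ #|kid v (3, 0)| + #|kid v (3, 1)| = alpha, #|size2_below par v| = #|kid v (3, 1)| &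
      forall a, a \notin [:: (3, 0); (3, 1)] -> #|kid v a| = 0].
Proof.
move=> vV; have ys y : child c par v y -> lab y \in [:: (3, 0); (3, 1)].
  move=> /(leg_of_branch H vV) y3; have := kids_small rt (eq_leq y3).
  rewrite /lab /label y3 /= => -[E -> _]; rewrite add0n.
  by move: E; rewrite !inE !xpair_eqE /=; lia.
have vm : #|subtree par v| = m by move: vV; rewrite inE => /eqP.
have al := pte_alpha H.
split; last by move=> a; apply: kids0.
- have := card_subE rt v; rewrite (sum_kids (fun a => a.1) _ ys) // !big_cons big_nil /=.
  by rewrite vm /m -/kid; lia.
- rewrite (card_size2_belowE rt) (sum_kids (fun a => a.2) _ ys) //.
  rewrite !big_cons big_nil /= vm -/kid /m.
  have -> : ((3 * alpha).+1 == 2) = false by lia.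
  lia.
Qed.

Lemma card_size2_below_le v : v \in V -> #|size2_below par v| <= alpha.
Proof. by case/kids_branch; lia. Qed.

Lemma kids_nonroot x a : x != c -> #|kid x a| = kids_of_label alpha (lab x) a.
Proof.
move=> xc; have al := pte_alpha H; rewrite /kids_of_label /lab /label.
case: (leqP #|subtree par x| 3) => [x3|x3].
  have [E1 E2 E0] := kids_small rt x3; rewrite -/lab -/kid in E1 E2 E0.
  case: (eqVneq a (1, 0)) => [->|a1]; first by lia.
  case: (eqVneq a (2, 1)) => [->|a2]; first by lia.
  by rewrite E0 // !inE negb_or a1.
have xV : x \in V.
  by rewrite inE; have := pte_size H xc; rewrite !inE; lia.
have [E1 E2 E0] := kids_branch xV.
case: (eqVneq a (3, 0)) => [->|a1]; first by lia.
case: (eqVneq a (3, 1)) => [->|a2]; first by lia.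
by rewrite E0 // !inE negb_or a1.
Qed.

Lemma kids_root s k :
  #|kid c (s, k)| = if s == m then #|[set v in V | #|size2_below par v| == k]| else 0.
Proof.
case: (eqVneq s m) => [->|sm]; last first.
  apply: eq_card0 => y; rewrite inE -(branchE H) inE; apply/negP => /andP [/eqP ym].
  by rewrite xpair_eqE ym eq_sym (negbTE sm).
apply: eq_card => v; rewrite [LHS]inE -(branchE H) [RHS]inE; case: (boolP (v \in V)) => //=.
by rewrite inE => /eqP vm; rewrite xpair_eqE vm eqxx.
Qed.

Lemma card_of_size2 : #|of_size par 2| = \sum_(v in V) #|size2_below par v|.
Proof.
have al := pte_alpha H; have n2 := pte_n H.
have := card_size2_belowE rt c; rewrite /size2_below (sub_c rt) setTI cardsT (pte_card H) -/m.
have -> : ((n * m).+1 == 2) = false by rewrite /m; apply/eqP; nia.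
by move=> ->; apply: eq_bigl => v; rewrite -(branchE H).
Qed.

Lemma size_c_gt x : x != c -> #|subtree par x| < #|subtree par c|.
Proof.
by move=> xc; apply: (card_sub_lt rt _ xc); rewrite (sub_c rt) inE.
Qed.

End PteLabels.

Lemma pte_isomorphic alpha n (G H : sgraph) (c : G) (c' : H) par par' :
  pte_rooted alpha n c par -> pte_rooted alpha n c' par' ->
  (forall k, #|[set v in of_size par (3 * alpha).+1 | #|size2_below par v| == k]| =
             #|[set v in of_size par' (3 * alpha).+1 | #|size2_below par' v| == k]|) ->
  #|of_size par 2| = #|of_size par' 2| ->
  isomorphic G H.
Proof.
move=> pG pH same same2.
have rtG := pte_rt pG; have rtH := pte_rt pH.
have cardGH : #|G| = #|H| by rewrite (pte_card pG) (pte_card pH).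
have labc : label par c = label par' c'.
  by rewrite /label /size2_below (sub_c rtG) (sub_c rtH) !setTI !cardsT cardGH same2.
apply: (label_iso rtG rtH labc) => // x y a E.
have sizeE : #|subtree par x| = #|subtree par' y| by case: E.
have sizec : #|subtree par c| = #|subtree par' c'| by case: labc.
case: (eqVneq x c) => [xc|xc]; case: (eqVneq y c') => [yc|yc].
- by rewrite xc yc; case: a => s k; rewrite (kids_root pG) (kids_root pH) same.
- by have := size_c_gt pH yc; rewrite -sizeE xc sizec ltnn.
- by have := size_c_gt pG xc; rewrite sizeE yc sizec ltnn.
- by rewrite (kids_nonroot pG) // E (kids_nonroot pH).
Qed.

(** [path_cut_stat] is conclusive when [j.*2 + 2 < (3 * alpha).+1]. For other
    [j <= alpha] one has [alpha = j = 1]; for [j > alpha] all terms vanish. *)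
Lemma pte_lambda_isomorphic alpha n (G H : sgraph) (c : G) (c' : H) par par' :
  pte_rooted alpha n c par -> pte_rooted alpha n c' par' ->
  (forall g, lambda_count G g = lambda_count H g) ->
  #|of_size par 2| = #|of_size par' 2| ->
  isomorphic G H.
Proof.
move=> pG pH same same2; apply: (pte_isomorphic pG pH) => //.
have al := pte_alpha pG.
apply: (@binomial_sums_determine _ _ _ _ _ _ alpha).
- exact: card_size2_below_le pG.
- exact: card_size2_below_le pH.
move=> j; case: (ltnP (j.*2 + 2) (3 * alpha).+1) => [js|jl].
  by rewrite -(lambda_count_path_cut pG js) -(lambda_count_path_cut pH js).
case: (leqP j alpha) => [ja|aj].
  have j1 : j = 1 by lia.
  rewrite j1 (eq_bigr _ (fun v _ => bin1 _)) [RHS](eq_bigr _ (fun v _ => bin1 _)).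
  by rewrite -(card_of_size2 pG) -(card_of_size2 pH).
have bin0 (K : sgraph) (p : K -> K) :
    {in of_size p (3 * alpha).+1, forall v, #|size2_below p v| <= alpha} ->
    \sum_(v in of_size p (3 * alpha).+1) 'C(#|size2_below p v|, j) = 0.
  by move=> le; apply: big1 => v /le vle; rewrite bin_small //; lia.
by rewrite !bin0 //; [exact: card_size2_below_le pH | exact: card_size2_below_le pG].
Qed.

(** * Recognizing a PTE-tree from single edge deletions *)

Definition edge_cut_stat (k : nat) : pred (seq nat) := fun l => (size l == 2) && (k \in l).

(** With this the number of edge sets gives back the number of vertices. *)
Lemma lambda_count_predT (G : sgraph) (c : G) par : rooted c par ->
  lambda_count G predT = 2 ^ #|G|.-1.
Proof.
move=> rt; rewrite (lambda_count_cut rt) -(cardsC1 c) -card_powerset.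
by apply: eq_card => X; rewrite !inE andbT subsetC sub1set inE.
Qed.

Lemma mem_lambda_edge_cut (G : sgraph) (c : G) par k x : rooted c par -> x != c ->
  (k \in lambda (kept c par [set x])) =
  (#|subtree par x| == k) || (#|G| - #|subtree par x| == k).
Proof.
move=> rt xc; have fibx : part c par [set x] x = subtree par x.
  apply/setP => u; rewrite inE (top_set1 rt) //.
  by case: (u \in subtree par x); rewrite ?eqxx // eq_sym (negbTE xc).
have fibc : part c par [set x] c = ~: subtree par x.
  apply/setP => u; rewrite inE in_setC (top_set1 rt) //.
  by case: (u \in subtree par x); rewrite ?eqxx // (negbTE xc).
have -> : #|G| - #|subtree par x| = #|~: subtree par x| by have := cardsC (subtree par x); lia.
rewrite (perm_mem (perm_lambda rt _)).
apply/imageP/orP => [[z + ->]|[] /eqP <-].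
- by rewrite !inE => /orP [] /eqP ->; [right; rewrite fibc | left; rewrite fibx].
- by exists x; rewrite ?fibx // !inE eqxx orbT.
- by exists c; rewrite ?setU11 // fibc.
Qed.

Lemma lambda_count_edge_cut (G : sgraph) (c : G) par k : rooted c par ->
  lambda_count G (edge_cut_stat k) =
  #|[set x | (x != c) && ((#|subtree par x| == k) || (#|G| - #|subtree par x| == k))]|.
Proof.
move=> rt; rewrite (lambda_count_cut rt) -[RHS](card_imset _ set1_inj).
apply: eq_card => X; rewrite inE /edge_cut_stat (size_lambda rt).
apply/idP/imsetP => [/and3P [cX]|[x + ->]].
  rewrite cardsU1 cX add1n eqSS => /cards1P [x Xx]; rewrite Xx in cX *.
  rewrite inE eq_sym in cX; rewrite mem_lambda_edge_cut // => kx.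
  by exists x; rewrite // inE cX kx.
rewrite inE => /andP [xc kx]; rewrite cards2 mem_lambda_edge_cut // inE.
by rewrite ![c == x]eq_sym xc kx.
Qed.

(** When no proper subtree exceeds half of the tree, a part of size less than half
    of it cut off by one edge lies below that edge. *)
Lemma lambda_count_edge_cut_small (G : sgraph) (c : G) par k : rooted c par ->
  (forall x, x != c -> #|subtree par x|.*2 <= #|G|) -> k.*2 < #|G| ->
  lambda_count G (edge_cut_stat k) = #|of_size par k|.
Proof.
move=> rt half kG; rewrite (lambda_count_edge_cut _ rt); apply: eq_card => x; rewrite !inE.
case: (eqVneq x c) => [->|xc] /=; first by rewrite (sub_c rt) cardsT; lia.
move: (half _ xc) kG; move: #|_| #|_| => a b; lia.
Qed.

Lemma pte_half alpha n (G : sgraph) (c : G) par : pte_rooted alpha n c par ->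
  (3 * alpha).+1.*2 < #|G| /\ forall x, x != c -> #|subtree par x|.*2 <= #|G|.
Proof.
move=> H; have n2 := pte_n H; have big : (3 * alpha).+1.*2 < #|G|.
  by rewrite (pte_card H); nia.
split=> // x xc; have := size_le_m H xc; lia.
Qed.

(** At a centroid of [H] the subtree sizes are those seen by deleting one edge, and
    each of them occurs for [G] as well, where they are at most m; the complements
    of subtrees of [G] are too large. *)
Lemma pte_of_lambda alpha n (G H : sgraph) (c : G) par :
  pte_rooted alpha n c par -> tree H ->
  (forall g, lambda_count G g = lambda_count H g) ->
  exists (c' : H) par', pte_rooted alpha n c' par' /\
    #|of_size par 2| = #|of_size par' 2|.
Proof.
move=> pG tH same; have [c' [par' [rt' half']]] := centroid tH.
have rt := pte_rt pG; have [big half] := pte_half pG; have al := pte_alpha pG.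
have cardGH : #|G| = #|H|.
  have := same predT; rewrite (lambda_count_predT rt) (lambda_count_predT rt').
  move=> /(expnI (isT : 1 < 2)).
  have : 0 < #|G| by apply/card_gt0P; exists c.
  have : 0 < #|H| by apply/card_gt0P; exists c'.
  lia.
have sizes k : k <= (3 * alpha).+1 -> #|of_size par k| = #|of_size par' k|.
  move=> km; rewrite -(lambda_count_edge_cut_small rt half) ?same; last by lia.
  by apply: (lambda_count_edge_cut_small rt' half'); lia.
exists c', par'; split; last by apply: sizes; lia.
split=> //; first exact: pte_n pG.
- by rewrite -cardGH (pte_card pG).
- move=> x xc; have := same (edge_cut_stat #|subtree par' x|).
  rewrite (lambda_count_edge_cut _ rt) (lambda_count_edge_cut _ rt') => E.
  have /card_gt0P [y] : 0 < #|[set y | (y != c) &&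
      ((#|subtree par y| == #|subtree par' x|) ||
       (#|G| - #|subtree par y| == #|subtree par' x|))]|.
    by rewrite E; apply/card_gt0P; exists x; rewrite inE xc eqxx.
  rewrite inE => /andP [yc /orP [/eqP <-|/eqP Ey]]; first exact: pte_size pG _ yc.
  by have := size_le_m pG yc; have := half' _ xc; lia.
- by rewrite -(sizes _ (leqnn _)) (pte_branches pG).
- by rewrite -(pte_legs pG) (sizes 3) //; lia.
Qed.

Lemma pte_rooted_transport (G K : sgraph) alpha n (c : K) par :
  isomorphic G K -> pte_rooted alpha n c par ->
  exists (c' : G) par', pte_rooted alpha n c' par'.
Proof.
case=> f [g fK gK] mono_f H; have [par_c cP adjE] := pte_rt H.
have f_inj := can_inj fK; pose par' := g \o par \o f.
have iterE k x : f (iter k par' x) = iter k par (f x).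
  by elim: k => //= k <-; rewrite /par' /= gK.
have fconnectE x z : fconnect par' x z = fconnect par (f x) (f z).
  apply/idP/idP => /iter_findex; first by move=> <-; rewrite iterE fconnect_iter.
  by rewrite -iterE => /f_inj <-; rewrite fconnect_iter.
have subE x : #|subtree par' x| = #|subtree par (f x)|.
  rewrite -(card_imset _ f_inj); apply: eq_card => y; rewrite inE.
  apply/imsetP/idP => [[u + ->]|yx]; first by rewrite inE fconnectE.
  by exists (g y); rewrite ?gK // inE fconnectE gK.
have sizeE k : #|of_size par' k| = #|of_size par k|.
  rewrite -(card_imset _ f_inj); apply: eq_card => y; rewrite inE.
  apply/imsetP/idP => [[u + ->]|yx]; first by rewrite inE subE.
  by exists (g y); rewrite ?gK // inE subE gK.
have fc x : (x == g c) = (f x == c) by rewrite -(inj_eq f_inj) gK.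
exists (g c), par'; split.
- split=> [|x|x y]; first by rewrite /par' /= gK par_c.
    by rewrite fconnectE gK.
  by rewrite -mono_f adjE !fc /par' /= -!(inj_eq f_inj (g _)) !gK.
- exact: pte_n H.
- exact: pte_alpha H.
- rewrite -(pte_card H) -[LHS]cardsT -[RHS]cardsT -(card_imset _ f_inj).
  by apply: eq_card => y; rewrite !inE; apply/imsetP; exists (g y); rewrite ?inE.
- by move=> x; rewrite fc subE; apply: pte_size H (f x).
- by rewrite sizeE (pte_branches H).
- by rewrite sizeE (pte_legs H).
Qed.

(** * The rooted tree of a compatible sequence *)

Section BRooted.
Variables a b : nat.

Definition B_par (u : B a b) : B a b :=
  match u with
  | None => None
  | Some (k, i) =>
    if i == 0 :> nat then None
    else if i == 1 :> nat then Some (k, inord 0)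
    else Some (k, if k is inl _ then inord 1 else inord 0)
  end.

Lemma Some_eqE (T : eqType) (x y : T) : (Some x == Some y) = (x == y).
Proof. by []. Qed.

Lemma B_rooted : rooted (B_root a b) B_par.
Proof.
split=> //.
  have cpar u : fconnect B_par u (B_par u) by exact: fconnect1.
  case=> [[k [[|[|[|//]]] lt]]|]; last exact: connect0.
  - exact: cpar.
  - by apply: connect_trans (cpar _) _; apply: connect_trans (cpar _) _; rewrite /= inordK.
  - apply: connect_trans (cpar _) _; apply: connect_trans (cpar _) _.
    by case: k => k; rewrite /= inordK //= ?inordK //;
      apply: connect_trans (cpar _) _; rewrite /= ?inordK.
have key (k k' : 'I_a + 'I_b) (i j : 'I_3) :
    (B_par (Some (k, i)) == Some (k', j)) =
    (k == k') && ((i == 1 :> nat) && (j == 0 :> nat) ||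
      (i == 2 :> nat) && (j == (if k is inl _ then 1 else 0) :> nat)).
  case: i => [[|[|[|//]]] lt] /=; rewrite ?andbF // Some_eqE xpair_eqE; congr (_ && _).
    by rewrite -val_eqE /= inordK //= orbF eq_sym.
  by case: k => ?; rewrite -val_eqE /= inordK // eq_sym.
move=> [[k i]|] [[k' j]|] //=; rewrite ?orbF.
- rewrite -[RHS]/((B_par (Some (k, i)) == Some (k', j)) ||
                  (B_par (Some (k', j)) == Some (k, i))).
  rewrite !key [k' == k]eq_sym; case: eqVneq => //= <-.
  case: k {key k'} => k; case: i => [[|[|[|//]]] ?]; case: j => [[|[|[|//]]] ?] //.
- by case: k => k; case: i => [[|[|[|//]]] ?].
- by case: k' => k; case: j => [[|[|[|//]]] ?].
Qed.

Definition copy_size (k : 'I_a + 'I_b) (i : 'I_3) : nat :=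
  if i == 0 :> nat then 3 else if i == 1 :> nat then (if k is inl _ then 2 else 1) else 1.

(** Whether vertex [j] of the leg [k] is [i] or a descendant of [i]; only in a path
    leg is 2 below 1. *)
Definition below (k : 'I_a + 'I_b) (i j : 'I_3) : bool :=
  [|| i == 0 :> nat, i == j |
      if k is inl _ then (i == 1 :> nat) && (j == 2 :> nat) else false].

Lemma fconnect_B k k' (i j : 'I_3) :
  fconnect B_par (Some (k', j)) (Some (k, i)) = (k' == k) && below k i j.
Proof.
have E := fconnect_parE B_rooted.
have f0 (l : 'I_3) : l = 0 :> nat ->
    fconnect B_par (Some (k', l)) (Some (k, i)) = (k' == k) && (i == l).
  by move=> l0; rewrite E /= l0 /= (fconnect_c B_rooted) orbF Some_eqE xpair_eqE (eq_sym l).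
have f1 (l : 'I_3) : l = 1 :> nat ->
    fconnect B_par (Some (k', l)) (Some (k, i)) = (k' == k) && ((i == l) || (i == 0 :> nat)).
  move=> l1; rewrite E /= l1 /= f0 ?inordK // Some_eqE xpair_eqE (eq_sym l) andb_orr.
  by rewrite -[i == inord 0]val_eqE /= inordK.
rewrite /below; case: j => [[|[|[|//]]] lt].
- rewrite f0 //; congr (_ && _); rewrite -val_eqE /=.
  by case: k {f0 f1} => ?; rewrite ?andbF ?orbF ?orbb.
- rewrite f1 //; congr (_ && _).
  by rewrite orbC; case: k {f0 f1} => ?; rewrite ?andbF ?orbF.
rewrite E /= Some_eqE xpair_eqE (eq_sym (Ordinal lt)).
case: k' f0 f1 => k' f0 f1; [rewrite f1 ?inordK // | rewrite f0 ?inordK //];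
  rewrite -andb_orr; case: eqVneq => //= <-; rewrite -!val_eqE /= inordK //.
  by case: (i) => [[|[|[|//]]] ?].
by case: (i) => [[|[|[|//]]] ?].
Qed.

Lemma card_B_sub k i : #|subtree B_par (Some (k, i) : B a b)| = copy_size k i.
Proof.
have -> : subtree B_par (Some (k, i) : B a b) = (fun j => Some (k, j)) @: [set j | below k i j].
  apply/setP => u; rewrite inE; apply/idP/imsetP => [|[j + ->]].
    case: u => [[k' j]|]; last by rewrite (fconnect_c B_rooted).
    by rewrite fconnect_B => /andP [/eqP -> ij]; exists j; rewrite ?inE.
  by rewrite inE fconnect_B eqxx.
rewrite card_imset => [|x y [] //]; rewrite -sum1_card big_mkcond /=.
rewrite !big_ord_recl big_ord0 !inE /below /copy_size.
by case: k => k; case: i => [[|[|[|//]]] ?].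
Qed.

End BRooted.

Section Talpha.
Variables (n : nat) (p s : 'I_n -> nat).
Local Notation K := (Tgraph p s).

Definition T_par (x : K) : K :=
  if x is Some y then
    if tagged y == B_root _ _ then None
    else Some (Tagged (fun i => B (p i) (s i)) (B_par (tagged y)))
  else None.

(** A name for this inclusion, whose type family is hard to infer. *)
Definition in_branch i (u : B (p i) (s i)) : K := Some (Tagged (fun i => B (p i) (s i)) u).

Lemma in_branch_inj i : injective (@in_branch i).
Proof. by move=> u v E; apply: eq_from_Tagged (Some_inj E). Qed.

Lemma T_par_in_branch i (u : B (p i) (s i)) :
  T_par (in_branch u) = if u == B_root _ _ then None else in_branch (B_par u).
Proof. by []. Qed.

Lemma in_branch_eq i (u v : B (p i) (s i)) : (in_branch u == in_branch v) = (u == v).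
Proof. by rewrite (inj_eq (@in_branch_inj i)). Qed.

Lemma in_branch_tag i j (u : B (p i) (s i)) (v : B (p j) (s j)) :
  in_branch u = in_branch v -> i = j.
Proof. by move/(congr1 (fun x : K => if x is Some y then tag y else i)). Qed.

Lemma in_branch_neq i j (u : B (p i) (s i)) (v : B (p j) (s j)) :
  i != j -> in_branch u != in_branch v.
Proof. by apply: contraNneq => /in_branch_tag/eqP. Qed.

(** Case analysis that keeps the dependent pairs folded. *)
Lemma K_case (x : K) : x = None \/ exists i (u : B (p i) (s i)), x = in_branch u.
Proof. by case: x => [[i u]|]; [right; exists i, u | left]. Qed.

Lemma T_rooted : rooted (None : K) T_par.
Proof.
split=> //.
  move=> x; case: (K_case x) => [->|[i [u ->]]]; first exact: connect0.
  elim/(rooted_ind (B_rooted (p i) (s i))): u => [|u ur IH].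
    by apply: connect_trans (fconnect1 _ _) _.
  apply: connect_trans (fconnect1 _ _) _.
  by rewrite T_par_in_branch (negbTE ur).
move=> x y; case: (K_case x) => [->|[i [u ->]]]; case: (K_case y) => [->|[j [v ->]]] //.
- by rewrite T_par_in_branch /= /in_branch; case: eqP.
- by rewrite T_par_in_branch /= /in_branch orbF; case: eqP.
rewrite !T_par_in_branch /= /T_rel.
case: (eqVneq i j) => [ij|ij]; last first.
  apply/esym/negbTE; rewrite negb_or.
  by apply/andP; split; case: ifP => // _; apply: in_branch_neq; rewrite // eq_sym.
case: j / ij v => v; rewrite /= tagged_asE.
have [_ _ /(_ u v) adjE] := B_rooted (p i) (s i).
rewrite /= in adjE; rewrite adjE.
by case: (u == B_root _ _); case: (v == B_root _ _) => //=; rewrite ?orbF ?in_branch_eq.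
Qed.

Lemma sub_in_branch i (v : B (p i) (s i)) :
  subtree T_par (in_branch v) = (@in_branch i) @: subtree (@B_par (p i) (s i)) v.
Proof.
apply/setP => x; rewrite inE; apply/idP/imsetP => [|[u + ->]]; last first.
  rewrite inE; elim/(rooted_ind (B_rooted (p i) (s i))): u => [|u ur IH].
    by rewrite (fconnect_c (B_rooted _ _)) => /eqP <-.
  rewrite (fconnect_parE (B_rooted _ _)) => /orP [/eqP -> //|/andP [_ /IH]].
  apply: connect_trans.
  have <- : T_par (in_branch u) = in_branch (B_par u).
    by rewrite T_par_in_branch (negbTE ur).
  exact: fconnect1.
elim/(rooted_ind T_rooted): x => [|x xc IH]; first by rewrite (fconnect_c T_rooted).
rewrite (fconnect_parE T_rooted) => /orP [/eqP ->|/andP [_ /IH]].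
  by exists v; rewrite ?mem_sub.
case=> u; rewrite inE => uv; case: (K_case x) xc => [->//|[j [w ->]] _].
rewrite T_par_in_branch; case: ifP => // wr wu.
have ji := in_branch_tag wu; case: i / ji v u uv wu {IH} => v u uv /in_branch_inj wu.
exists w => //; rewrite inE; apply: connect_trans uv.
by rewrite -wu fconnect1.
Qed.

Lemma card_sub_in_branch i (v : B (p i) (s i)) :
  #|subtree T_par (in_branch v)| = #|subtree (@B_par (p i) (s i)) v|.
Proof. by rewrite sub_in_branch (card_imset _ (@in_branch_inj i)). Qed.

End Talpha.

Lemma card_B a b : #|B a b| = (3 * (a + b)).+1.
Proof. by rewrite card_option card_prod card_sum !card_ord mulnC. Qed.

Lemma Talpha_pte alpha n (p : 'I_n -> nat) : 0 < alpha -> compatible alpha p ->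
  pte_rooted alpha n (None : Talpha alpha p) (@T_par _ _ _).
Proof.
move=> al [n2 /bigmax_leqP pal].
have pa i : p i + (alpha - p i) = alpha by rewrite subnKC // pal.
have rt := T_rooted p (fun i => alpha - p i).
have card_sum_const (f : 'I_n -> nat) k : (forall i, f i = k) ->
    sumn [seq f i | i <- enum 'I_n] = n * k.
  move=> fk; rewrite sumnE big_map big_enum /= (eq_bigr _ (fun i _ => fk i)).
  by rewrite sum_nat_const card_ord.
have cardK : #|Talpha alpha p| = (n * (3 * alpha).+1).+1.
  rewrite card_option card_tagged; congr _.+1; apply: card_sum_const => i.
  by rewrite card_B pa.
pose br i := @in_branch n p (fun i => alpha - p i) i.
have size_root i : #|subtree (@T_par _ _ _) (br i None)| = (3 * alpha).+1.
  rewrite card_sub_in_branch (sub_c (B_rooted _ _)) cardsT card_B pa //.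
have size_copy i k j : #|subtree (@T_par _ _ _) (br i (Some (k, j)))| = copy_size k j.
  by rewrite card_sub_in_branch card_B_sub.
have size_c : #|subtree (@T_par _ _ _) (None : Talpha alpha p)| = (n * (3 * alpha).+1).+1.
  by rewrite (sub_c rt) cardsT.
split=> //.
- move=> x; case: (K_case x) => [->|[i [[[k j]|] ->]] _]; first by rewrite eqxx.
    rewrite size_copy /copy_size; case: ifP => // _; case: ifP => // _.
    by case: k.
  by rewrite size_root !inE eqxx !orbT.
- rewrite -[RHS]card_ord -(card_imset predT (f := fun i => br i None)); last first.
    by move=> i j /in_branch_tag.
  apply: eq_card => x; rewrite inE; apply/eqP/imsetP => [|[i _ ->]]; last exact: size_root.
  case: (K_case x) => [->|[i [[[k j]|] ->]]]; last by exists i.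
    by rewrite size_c; nia.
  rewrite size_copy /copy_size; case: ifP => _; last case: ifP => _; last by lia.
    by lia.
  by case: (k) => ?; lia.
- pose leg (y : {i : 'I_n & ('I_(p i) + 'I_(alpha - p i))%type}) : Talpha alpha p :=
    br (tag y) (Some (tagged y, ord0)).
  have leg_inj : injective leg.
    move=> [i k] [j l] E; have /= ij := in_branch_tag E.
    by case: j / ij l E => l /in_branch_inj [->].
  have <- : #|{: {i : 'I_n & ('I_(p i) + 'I_(alpha - p i))%type}}| = n * alpha.
    by rewrite card_tagged; apply: card_sum_const => i; rewrite card_sum !card_ord pa.
  rewrite -(card_imset predT leg_inj).
  apply: eq_card => x; rewrite inE; apply/eqP/imsetP => [|[y _ ->]]; last by rewrite size_copy.
  case: (K_case x) => [->|[i [[[k j]|] ->]]].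
  + by rewrite size_c; nia.
  + rewrite size_copy /copy_size; case: ifP => [j0 _|_]; last by case: ifP => //; case: k.
    exists (Tagged (fun i => ('I_(p i) + 'I_(alpha - p i))%type) k) => //.
    by rewrite /leg (_ : j = ord0) //; apply/val_inj/eqP.
  + by rewrite size_root; lia.
Qed.

Theorem corollary2p6 (T T' : sgraph) (hT : PTE_tree T) (hT' : tree T')
    (hU : Upoly T = Upoly T') : isomorphic T' T.
Proof.
have [_ [alpha [n [p [al comp iso]]]]] := hT.
have [c [par pT]] := pte_rooted_transport iso (Talpha_pte al comp).
have same := Upoly_lambda_count hU.
have [c' [par' [pT' same2]]] := pte_of_lambda pT hT' same.
by apply: (pte_lambda_isomorphic pT' pT) => [g|]; rewrite ?same ?same2.
Qed.
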